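(* Let $n\ge 5$ be a fixed integer with $n\equiv 1 \pmod 4$, and let $\Delta_n(a,b)$ denote the discriminant of the trinomial $f_{n,a,b}(t)=t^n+at+b$. For real numbers $A\ge 1$, $B\ge 1$, $C\ge 0$, $D\ge 0$ and a square-free integer $s$, let $T_n(A,B,C,D;s)$ be the number of pairs of integers $(a,b)\in[C,C+A]\times[D,D+B]$ such that $\Delta_n(a,b)=sr^2$ for some integer $r$. Then $$ T_n(A,B,C,D;s) \ll (AB)^{2/3}\log(AB) + A\log(AB) + B\log(AB) + (AB)^{1/3}\left(\frac{\log(ABCD)\,\log(AB)}{\log\log(ABCD)}\right)^2, $$ where the implied constant depends only on $n$ (in particular it is uniform in $s$, $A$, $B$, $C$, $D$).
   Context: For $n\equiv 1\pmod 4$ one has $\Delta_n(a,b)=(n-1)^{n-1}a^n+n^nb^{n-1}$. Notation: $U\ll V$ means $|U|\le cV$ for some constant $c>0$ depending only on $n$. For $x$ real, $\log x$ denotes the maximum of the natural logarithm of $x$ and $1$ (so $\log x\ge 1$ always; in particular this is the convention when $x\le e$, including $x=0$). *)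

(* Defs.v *)
From Stdlib Require Import Reals ZArith List ClassicalEpsilon.
Open Scope R_scope.

(* log x := max(ln x, 1), as in the paper's convention. *)
Definition logm (x : R) : R := Rmax (ln x) 1.

(* Discriminant of t^n + a t + b for n = 1 mod 4 (formula from the context). *)
Definition Delta (n : nat) (a b : Z) : Z :=
  ((Z.of_nat n - 1) ^ (Z.of_nat n - 1) * a ^ (Z.of_nat n)
   + (Z.of_nat n) ^ (Z.of_nat n) * b ^ (Z.of_nat n - 1))%Z.

Definition squarefree (s : Z) : Prop :=
  s <> 0%Z /\ forall d : Z, (d * d | s)%Z -> (d = 1 \/ d = -1)%Z.

(* integers 0, 1, ..., up X ; this contains every integer in [0, X] *)
Definition zrange (X : R) : list Z :=
  map Z.of_nat (seq 0 (S (Z.to_nat (up X)))).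

Definition T_pred (n : nat) (A B C D : R) (s : Z) (p : Z * Z) : Prop :=
  C <= IZR (fst p) <= C + A /\ D <= IZR (snd p) <= D + B /\
  exists r : Z, Delta n (fst p) (snd p) = (s * r ^ 2)%Z.

Definition decb (P : Prop) : bool :=
  if excluded_middle_informative P then true else false.

Definition T_n (n : nat) (A B C D : R) (s : Z) : nat :=
  length (filter (fun p => decb (T_pred n A B C D s p))
                 (list_prod (zrange (C + A)) (zrange (D + B)))).

(* Main.v *)
(** A square sieve in which the character sums are estimated on average, so that no Weil bound is needed.

    Let z be about (AB)^(1/3), let P be the set of primes in (z, 4z], and put q = |P|.
    If Delta(a,b) = s r^2, then chi_p(s) chi_p(Delta(a,b)) = 1 for every p in P not dividing
    Delta(a,b); hence q^2 T is at most the sum over the box of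
    2 (sum_p chi_p(s) chi_p(Delta(a,b)))^2, up to the contribution of the primes dividing
    Delta(a,b), which is small on average because Delta(.,b) has at most n roots modulo p.

    Smoothing the box by a difference of two boxes, the off-diagonal term of two primes l <> r
    becomes a bilinear form, which AM-GM splits into two positive quantities Q(l,r) and Q(r,l).
    Q(l,r) is a sum of squares of sums of chi_l(Delta) over grids of step r, so, being
    nonnegative, its sum over the primes r is at most its sum over all steps r modulo l.
    Delta is weighted homogeneous: Delta(x^(n-1) a, x^n b) = x^(n(n-1)) Delta(a,b) with n(n-1)
    even, so averaging the correlation of chi_l(Delta) over all dilations of a shift amounts to
    averaging it over all shifts; this reduces everything to second moments of
    one-dimensional sums of chi_l(Delta), and those are elementary because a = b t (or b = a t)
    makes Delta, up to an even power, affine in the remaining variable.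

    Together with Chebyshev's bound q >> z / log z this gives
    T << log(AB) ((AB)^(2/3) + A + B). *)

Require Import Defs.
From Stdlib Require Import Reals ZArith List Lra Lia ClassicalEpsilon FinFun.
From mathcomp Require all_boot all_order all_algebra all_field zify ssrZ ring lra.
From HB Require structures.
Open Scope R_scope.

Module Sieve.

Import structures all_boot all_order all_algebra all_field zify ssrZ ring lra.
Import Order.TTheory GRing.Theory Num.Theory.
Set Implicit Arguments.
Unset Strict Implicit.
Unset Printing Implicit Defensive.
Local Open Scope ring_scope.

(** * Quadratic characters of finite fields *)

(** Euler's criterion. The values are taken in [int], so that characters of different fields can be
    multiplied and summed together. *)
Definition qchar (F : finFieldType) (x : F) : int :=
  if x == 0 then 0 else if x ^+ (#|F|.-1)./2 == 1 then 1 else -1.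

Lemma qchar0 (F : finFieldType) : qchar (0 : F) = 0.
Proof. by rewrite /qchar eqxx. Qed.

Lemma qchar_half (F : finFieldType) (x : F) : odd #|F| -> x != 0 ->
  x ^+ (#|F|.-1)./2 = 1 \/ x ^+ (#|F|.-1)./2 = -1.
Proof.
move=> oF x0.
have c1 : (1 < #|F|)%N by exact: finNzRing_gt1.
have E : (x ^+ (#|F|.-1)./2) ^+ 2 = 1.
  rewrite -exprM muln2 even_halfK; last by lia.
  apply: (mulfI x0); rewrite -exprS prednK ?expf_card ?mulr1 //; lia.
move/eqP: E; rewrite sqrf_eq1 => /orP[/eqP->|/eqP->]; by [left|right].
Qed.

Lemma qcharM (F : finFieldType) (x y : F) : odd #|F| -> qchar (x * y) = qchar x * qchar y.
Proof.
move=> oF; rewrite /qchar mulf_eq0.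
case: eqVneq => x0 /=; first by rewrite mul0r.
case: eqVneq => y0 /=; first by rewrite mulr0.
rewrite exprMn.
have [->|->] := qchar_half oF x0; have [->|->] := qchar_half oF y0;
  rewrite ?mulrNN ?mulr1 ?mul1r eqxx; by case: ((-1 : F) == 1).
Qed.

Lemma qchar_sqr (F : finFieldType) (x : F) : odd #|F| -> x != 0 -> qchar (x ^+ 2) = 1.
Proof.
move=> oF x0; rewrite expr2 qcharM // /qchar (negPf x0).
by case: ifP; rewrite ?mulrNN mulr1.
Qed.

Lemma qchar_even_exp (F : finFieldType) (x : F) k :
  odd #|F| -> x != 0 -> ~~ odd k -> qchar (x ^+ k) = 1.
Proof.
move=> oF x0 ek; rewrite -(even_halfK ek) -mul2n mulnC exprM qchar_sqr //.
by rewrite expf_neq0.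
Qed.

Lemma qchar_sqr_le1 (F : finFieldType) (x : F) : qchar x ^+ 2 <= 1.
Proof. by rewrite /qchar; case: ifP => // _; case: ifP. Qed.

Lemma qchar_sqr1 (F : finFieldType) (x : F) : x != 0 -> qchar x ^+ 2 = 1.
Proof. by rewrite /qchar => /negPf ->; case: ifP. Qed.

Lemma qchar_mul_le1 (F K : finFieldType) (x : F) (y : K) : qchar x * qchar y <= 1.
Proof. by rewrite /qchar; do ?case: ifP. Qed.

(** Otherwise every nonzero element would be a root of X^h - 1 with h = (|F| - 1) / 2, which is more
    roots than the degree allows. *)
Lemma qchar_nonresidue (F : finFieldType) : odd #|F| ->
  exists2 g : F, g != 0 & qchar g = -1.
Proof.
move=> oF; have c1 : (1 < #|F|)%N by exact: finNzRing_gt1.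
set h := (#|F|.-1)./2; have h0 : (0 < h)%N by rewrite /h half_gt0; move: oF c1; case: #|F| => [|[|[|]]].
case: (pickP (fun g : F => (g != 0) && (g ^+ h != 1))) => [g /andP[g0 gh]|H].
  by exists g => //; rewrite /qchar (negPf g0) (negPf gh).
exfalso; pose p : {poly F} := 'X^h - 1.
have sp : size p = h.+1 by rewrite size_XnsubC.
have pn0 : p != 0 by rewrite -size_poly_eq0 sp.
have := max_poly_roots pn0 (rs := enum [pred x : F | x != 0]).
rewrite sp enum_uniq -cardE => /(_ _ isT) /=.
have -> : #|[pred x : F | x != 0]| = #|F|.-1 by rewrite -(cardC1 (0 : F)).
have -> : all (root p) (enum [pred x : F | x != 0]).
  apply/allP => x; rewrite mem_enum inE => x0.
  have := H x; rewrite x0 /= => /negbFE /eqP xh.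
  by rewrite /root !hornerE xh subrr.
by move=> /(_ isT); rewrite /h in h0 *; move: h0; set m := _.-1; lia.
Qed.

(** Multiplying the variable by a nonresidue permutes the field and changes the sign of the sum. *)
Lemma sum_qchar (F : finFieldType) : odd #|F| -> \sum_(x : F) qchar x = 0.
Proof.
move=> oF; have [g g0 Hg] := qchar_nonresidue oF.
have E : \sum_(x : F) qchar x = \sum_(x : F) qchar (g * x).
  by rewrite (reindex (fun x => g * x)) //; exists (fun x => g^-1 * x) => x _; rewrite ?mulKf ?mulVKf.
move: E; under [X in _ = X]eq_bigr => x _ do rewrite qcharM // Hg mulN1r.
by rewrite sumrN; move: (\sum_x _) => S; lia.
Qed.

Lemma sum_qchar_affine (F : finFieldType) (a b : F) : odd #|F| -> a != 0 ->
  \sum_(x : F) qchar (a * x + b) = 0.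
Proof.
move=> oF a0; rewrite -[RHS](sum_qchar oF) [RHS](reindex (fun x => a * x + b)) //.
by exists (fun x => a^-1 * (x - b)) => x _; rewrite ?addrK ?mulKf ?mulVKf ?subrK.
Qed.

(** For nonzero [a] and [b], a linear substitution turns the argument of the product into (u y + e)
    y, and inverting y turns this, up to the square y^2, into e y + u. The complete affine sum
    vanishes, so what is left is minus its term at y = 0. *)
Lemma sum_qchar_pair (F : finFieldType) (a b c d : F) : odd #|F| ->
  a * d != b * c -> \sum_(x : F) qchar (a * x + c) * qchar (b * x + d) <= 1.
Proof.
move=> oF ne.
have [a0|a0] := eqVneq a 0.
  rewrite (eq_bigr (fun x => qchar c * qchar (b * x + d))); last by move=> x _; rewrite a0 mul0r add0r.
  rewrite -mulr_sumr sum_qchar_affine ?mulr0 //.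
  by apply: contraNneq ne => ->; rewrite a0 !mul0r.
have [b0|b0] := eqVneq b 0.
  rewrite (eq_bigr (fun x => qchar (a * x + c) * qchar d)); last by move=> x _; rewrite b0 mul0r add0r.
  by rewrite -mulr_suml sum_qchar_affine ?mul0r.
pose u := a / b; pose e := c - u * d.
have u0 : u != 0 by rewrite mulf_neq0 ?invr_eq0.
have e0 : e != 0.
  apply: contraNneq ne => E.
  have -> : c = u * d by apply/eqP; rewrite -subr_eq0 -/e E.
  by rewrite /u; apply/eqP; field.
have -> : \sum_(x : F) qchar (a * x + c) * qchar (b * x + d) =
          \sum_(y : F) qchar (u * y + e) * qchar y.
  rewrite [RHS](reindex (fun x => b * x + d)) /=; last first.
    by exists (fun x => b^-1 * (x - d)) => x _; rewrite ?addrK ?mulKf ?mulVKf ?subrK.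
  apply: eq_bigr => x _; congr (qchar _ * _).
  by rewrite /e /u; field.
rewrite (bigD1 0) //= qchar0 mulr0 add0r.
have -> : \sum_(y : F | y != 0) qchar (u * y + e) * qchar y =
          \sum_(y : F | y != 0) qchar (e * y + u).
  rewrite [RHS](reindex (fun y => y^-1)) /=; last first.
    by exists (fun y => y^-1) => y _; rewrite invrK.
  apply: eq_big => y; first by rewrite invr_eq0.
  move=> y0; rewrite -qcharM //.
  have -> : (u * y + e) * y = (e * y^-1 + u) * y ^+ 2 by field.
  by rewrite qcharM // qchar_sqr // mulr1.
have := sum_qchar_affine u oF e0; rewrite (bigD1 0) //= mulr0 add0r => /eqP.
rewrite addrC addr_eq0 => /eqP ->.
by rewrite /qchar; do ?case: ifP.
Qed.

Lemma card_exp_fiber (F : finFieldType) (k : nat) (c : F) : (0 < k)%N ->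
  (#|[pred x : F | (x ^+ k == c)%R]| <= k)%N.
Proof.
move=> k0; pose p : {poly F} := 'X^k - c%:P.
have sp : size p = k.+1 by rewrite size_XnsubC.
have pn0 : p != 0 by rewrite -size_poly_eq0 sp.
have := max_poly_roots pn0 (rs := enum [pred x : F | x ^+ k == c]).
rewrite sp enum_uniq -cardE ltnS; apply => //.
apply/allP => x; rewrite mem_enum inE => /eqP E.
by rewrite /root !hornerE E subrr.
Qed.

(** After the square is expanded, a proportional pair (t, t') contributes at most |F|, and each t
    has at most k such partners; every other pair contributes at most 1 by [sum_qchar_pair]. *)
Lemma sum_sqr_sum_qchar (F : finFieldType) (a c : F -> F) (k : nat) : odd #|F| ->
  (forall t, #|[pred t' | (a t * c t' == a t' * c t)%R]| <= k)%N ->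
  \sum_(x : F) (\sum_(t : F) qchar (a t * x + c t)) ^+ 2 <= (k%:R + 1) * #|F|%:R ^+ 2.
Proof.
move=> oF H.
have -> : \sum_(x : F) (\sum_(t : F) qchar (a t * x + c t)) ^+ 2 =
  \sum_(t : F) \sum_(t' : F) \sum_(x : F) qchar (a t * x + c t) * qchar (a t' * x + c t').
  under eq_bigr => x _ do rewrite expr2 big_distrlr /=.
  by rewrite exchange_big /=; apply: eq_bigr => t _; rewrite exchange_big.
have B t : \sum_(t' : F) \sum_(x : F) qchar (a t * x + c t) * qchar (a t' * x + c t')
   <= (k%:R + 1) * #|F|%:R.
  apply: (@le_trans _ _ (\sum_(t' : F) ((a t * c t' == a t' * c t)%:R * #|F|%:R + 1))).
    apply: ler_sum => t' _; case: eqVneq => E.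
      rewrite mul1r -[X in X <= _]addr0 lerD //.
      rewrite -sum1_card natr_sum; apply: ler_sum => x _; exact: qchar_mul_le1.
    by rewrite mul0r add0r sum_qchar_pair.
  rewrite big_split /= -mulr_suml sumr_const mulrDl mul1r lerD // ler_wpM2r ?ler0n //.
  rewrite -natr_sum ler_nat; apply: leq_trans (H t).
  by rewrite -sum1_card [leqRHS]big_mkcond /=; apply: leq_sum => t' _; rewrite inE; case: ifP.
apply: le_trans (ler_sum _ (fun t _ => B t)) _.
by rewrite sumr_const -[X in X <= _]mulr_natr expr2 mulrA.
Qed.

(** * Second moments and correlations of the discriminant character *)

Lemma sqr_sum_le_card (T : finType) (g : T -> int) :
  (forall x, g x ^+ 2 <= 1) -> (\sum_x g x) ^+ 2 <= #|T|%:R ^+ 2.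
Proof.
move=> H; rewrite -real_normK ?num_real // ler_sqr ?nnegrE ?ler0n //.
apply: le_trans (ler_norm_sum _ _ _) _.
apply: (@le_trans _ _ (\sum_(x : T) 1)); last by rewrite sumr_const.
by apply: ler_sum => x _; rewrite -(@expr_le1 _ 2) // real_normK ?num_real.
Qed.

Lemma sqr_sum_le (T : finType) (u : T -> int) :
  (\sum_x u x) ^+ 2 <= #|T|%:R * \sum_x u x ^+ 2.
Proof.
suff : ((\sum_x u x) ^+ 2) *+ 2 <= (#|T|%:R * \sum_x u x ^+ 2) *+ 2 by rewrite lerMn2r.
rewrite expr2 big_distrlr /= -sumrMnl.
have -> : (#|T|%:R * \sum_x u x ^+ 2) *+ 2 = \sum_x \sum_y (u x ^+ 2 + u y ^+ 2).
  under [RHS]eq_bigr => x _ do rewrite big_split /= sumr_const.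
  by rewrite big_split /= sumr_const -sumrMnl mulr2n mulr_natl -sumrMnl.
apply: ler_sum => x _; rewrite -sumrMnl; apply: ler_sum => y _.
have := sqr_ge0 (u x - u y); rewrite sqrrB; lia.
Qed.

(** The polynomial [Delta] over a field. The two variables form one argument because shifts are
    later taken in the product group. *)
Definition disc (F : finFieldType) (n : nat) (x : F * F) : F :=
  n.-1%:R ^+ n.-1 * x.1 ^+ n + n%:R ^+ n * x.2 ^+ n.-1.

Definition qdisc (F : finFieldType) (n : nat) (x : F * F) : int := qchar (disc n x).

Lemma qdisc_sqr_le1 (F : finFieldType) n (x : F * F) : qdisc n x ^+ 2 <= 1.
Proof. exact: qchar_sqr_le1. Qed.

Lemma qdisc_homog (F : finFieldType) n (l : F) (x : F * F) :
  odd #|F| -> l != 0 -> odd n ->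
  qdisc n (l ^+ n.-1 * x.1, l ^+ n * x.2) = qdisc n x.
Proof.
move=> oF l0 on; rewrite /qdisc /disc /=.
have -> : n.-1%:R ^+ n.-1 * (l ^+ n.-1 * x.1) ^+ n + n%:R ^+ n * (l ^+ n * x.2) ^+ n.-1 =
  l ^+ (n.-1 * n) * (n.-1%:R ^+ n.-1 * x.1 ^+ n + n%:R ^+ n * x.2 ^+ n.-1).
  rewrite !exprMn -!exprM (mulnC n n.-1).
  by ring.
by rewrite qcharM // qchar_even_exp ?mul1r // oddM; case: n on => //= n /negPf ->.
Qed.

(** The substitution b = a t splits off the even power a^(n-1) and leaves a form affine in a, so
    [sum_sqr_sum_qchar] applies; t and t' are proportional only if t^(n-1) = t'^(n-1). The row a = 0
    is bounded trivially by |F|^2, whence n + 2 = 1 + (n + 1). *)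
Lemma qdisc_row (F : finFieldType) n : odd #|F| -> odd n -> (1 < n)%N ->
  n.-1%:R != 0 :> F -> n%:R != 0 :> F ->
  \sum_(a : F) (\sum_(b : F) qdisc n (a, b)) ^+ 2 <= n.+2%:R * #|F|%:R ^+ 2.
Proof.
move=> oF on n1 c1 c2.
have {}c1 : (n.-1%:R : F) ^+ n.-1 != 0 by rewrite expf_neq0.
have {}c2 : (n%:R : F) ^+ n != 0 by rewrite expf_neq0.
rewrite (bigD1 0) //=.
have -> : n.+2%:R * #|F|%:R ^+ 2 = #|F|%:R ^+ 2 + (n%:R + 1) * #|F|%:R ^+ 2 :> int.
  by rewrite -[n.+2]addn2 natrD; ring.
apply: lerD; first by apply: sqr_sum_le_card => b; exact: qdisc_sqr_le1.
apply: le_trans (@sum_sqr_sum_qchar F (fun=> n.-1%:R ^+ n.-1)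
  (fun t => n%:R ^+ n * t ^+ n.-1) n oF _); last first.
  move=> t; apply: (@leq_trans n.-1); last by lia.
  have n10 : (0 < n.-1)%N by lia.
  apply: leq_trans (card_exp_fiber (t ^+ n.-1) n10).
  apply: subset_leq_card; apply/subsetP => t'; rewrite !inE.
  by move=> /eqP /(mulfI c1) /(mulfI c2) ->.
rewrite [leRHS](bigD1 0) //= -[leLHS]add0r lerD ?sqr_ge0 //.
apply: ler_sum => a a0; rewrite le_eqVlt; apply/orP; left; apply/eqP; congr (_ ^+ 2).
rewrite (reindex (fun t => a * t)) /=; last first.
  by exists (fun x => a^-1 * x) => x _; rewrite ?mulKf ?mulVKf.
apply: eq_bigr => t _; rewrite /qdisc /disc /=.
have -> : n.-1%:R ^+ n.-1 * a ^+ n + n%:R ^+ n * (a * t) ^+ n.-1 =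
   a ^+ n.-1 * (n.-1%:R ^+ n.-1 * a + n%:R ^+ n * t ^+ n.-1).
  rewrite exprMn; have -> : a ^+ n = a * a ^+ n.-1 by rewrite -exprS prednK // ltnW.
  by ring.
by rewrite qcharM // qchar_even_exp ?mul1r //; lia.
Qed.

(** The same with a = b t: now t^n sits in the leading coefficient of a form affine in b. *)
Lemma qdisc_col (F : finFieldType) n : odd #|F| -> odd n -> (1 < n)%N ->
  n.-1%:R != 0 :> F -> n%:R != 0 :> F ->
  \sum_(b : F) (\sum_(a : F) qdisc n (a, b)) ^+ 2 <= n.+2%:R * #|F|%:R ^+ 2.
Proof.
move=> oF on n1 c1 c2.
have {}c1 : (n.-1%:R : F) ^+ n.-1 != 0 by rewrite expf_neq0.
have {}c2 : (n%:R : F) ^+ n != 0 by rewrite expf_neq0.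
rewrite (bigD1 0) //=.
have -> : n.+2%:R * #|F|%:R ^+ 2 = #|F|%:R ^+ 2 + (n%:R + 1) * #|F|%:R ^+ 2 :> int.
  by rewrite -[n.+2]addn2 natrD; ring.
apply: lerD; first by apply: sqr_sum_le_card => b; exact: qdisc_sqr_le1.
apply: le_trans (@sum_sqr_sum_qchar F (fun t => n.-1%:R ^+ n.-1 * t ^+ n)
  (fun=> n%:R ^+ n) n oF _); last first.
  move=> t; have n0 : (0 < n)%N by lia.
  apply: leq_trans (card_exp_fiber (t ^+ n) n0).
  apply: subset_leq_card; apply/subsetP => t'; rewrite !inE.
  by move=> /eqP /(mulIf c2) /(mulfI c1) ->.
rewrite [leRHS](bigD1 0) //= -[leLHS]add0r lerD ?sqr_ge0 //.
apply: ler_sum => b b0; rewrite le_eqVlt; apply/orP; left; apply/eqP; congr (_ ^+ 2).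
rewrite (reindex (fun t => b * t)) /=; last first.
  by exists (fun x => b^-1 * x) => x _; rewrite ?mulKf ?mulVKf.
apply: eq_bigr => t _; rewrite /qdisc /disc /=.
have -> : n.-1%:R ^+ n.-1 * (b * t) ^+ n + n%:R ^+ n * b ^+ n.-1 =
   b ^+ n.-1 * (n.-1%:R ^+ n.-1 * t ^+ n * b + n%:R ^+ n).
  rewrite exprMn; have -> : b ^+ n = b * b ^+ n.-1 by rewrite -exprS prednK // ltnW.
  by ring.
by rewrite qcharM // qchar_even_exp ?mul1r //; lia.
Qed.

Lemma sum_pair (T1 T2 : finType) (f : T1 * T2 -> int) :
  \sum_p f p = \sum_a \sum_b f (a, b).
Proof. by rewrite pair_bigA; apply: eq_bigr => -[]. Qed.

(* Makes the product of two finite abelian groups a canonical finZmodType. *)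
HB.saturate prod.

Definition corr (V : finZmodType) (g : V -> int) (d : V) : int :=
  \sum_(x : V) g x * g (x + d).

Lemma corr0_le (V : finZmodType) (g : V -> int) :
  (forall x, g x ^+ 2 <= 1) -> corr g 0 <= #|V|%:R.
Proof.
move=> H; rewrite /corr -sum1_card natr_sum; apply: ler_sum => x _.
by rewrite addr0 -expr2.
Qed.

Lemma sum_shift (V : finZmodType) (h : V -> int) (c : V) :
  \sum_x h (c + x) = \sum_x h x.
Proof.
rewrite [RHS](reindex (fun x => c + x)) //.
by exists (fun x => - c + x) => x _; rewrite ?addKr ?addNKr.
Qed.

Lemma sum_corr (V : finZmodType) (g : V -> int) :
  \sum_d corr g d = (\sum_x g x) ^+ 2.
Proof.
rewrite /corr exchange_big /= expr2 mulr_suml; apply: eq_bigr => x _.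
by rewrite -mulr_sumr sum_shift.
Qed.

Lemma sum_corr_row (U W : finZmodType) (g : U * W -> int) :
  \sum_k corr g (0, k) = \sum_a (\sum_b g (a, b)) ^+ 2.
Proof.
rewrite /corr exchange_big /= sum_pair.
apply: eq_bigr => a _; rewrite expr2 mulr_suml; apply: eq_bigr => b _.
rewrite -mulr_sumr; congr (_ * _).
rewrite -[RHS](sum_shift (fun x => g (a, x)) b); apply: eq_bigr => k _.
by congr g; congr pair; rewrite /= addr0.
Qed.

Lemma sum_corr_col (U W : finZmodType) (g : U * W -> int) :
  \sum_h corr g (h, 0) = \sum_b (\sum_a g (a, b)) ^+ 2.
Proof.
rewrite /corr exchange_big /= sum_pair.
rewrite exchange_big /=.
apply: eq_bigr => b _; rewrite expr2 mulr_suml; apply: eq_bigr => a _.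
rewrite -mulr_sumr; congr (_ * _).
rewrite -[RHS](sum_shift (fun x => g (x, b)) a); apply: eq_bigr => k _.
by congr g; congr pair; rewrite /= addr0.
Qed.

(** The dilation is additive and bijective, so it can be applied to the summation variable and the
    shift at once. *)
Lemma corr_homog (F : finFieldType) (g : F * F -> int) n (l : F) (d : F * F) :
  (forall (l : F) x, l != 0 -> g (l ^+ n.-1 * x.1, l ^+ n * x.2) = g x) -> l != 0 ->
  corr g (l ^+ n.-1 * d.1, l ^+ n * d.2) = corr g d.
Proof.
move=> H l0; rewrite /corr.
have [l1 l2] : l ^+ n.-1 != 0 /\ l ^+ n != 0 by rewrite !expf_neq0.
rewrite (reindex (fun x : F * F => (l ^+ n.-1 * x.1, l ^+ n * x.2))) /=; last first.
  exists (fun x : F * F => ((l ^+ n.-1)^-1 * x.1, (l ^+ n)^-1 * x.2)) => -[x y] _ /=;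
  by rewrite ?mulKf ?mulVKf.
apply: eq_bigr => x _; rewrite H //; congr (_ * _).
by rewrite -[RHS](H l) //; congr g; congr pair; rewrite /= mulrDr.
Qed.

(* (l, r) |-> (r l^(n-1) x, r l^n y) is a permutation of the pairs of nonzero elements. *)
Lemma corr_ray_generic (F : finFieldType) (g : F * F -> int) n (x y : F) : (0 < n)%N ->
  (forall (l : F) x, l != 0 -> g (l ^+ n.-1 * x.1, l ^+ n * x.2) = g x) ->
  x != 0 -> y != 0 ->
  #|F|.-1%:R * \sum_(r | r != 0) corr g (r * x, r * y) =
  \sum_(h | h != 0) \sum_(k | k != 0) corr g (h, k).
Proof.
move=> n0 H x0 y0.
rewrite [RHS](pair_big _ _ (fun h k => corr g (h, k))) /=.
rewrite [RHS](reindex (fun p : F * F => (p.2 * p.1 ^+ n.-1 * x, p.2 * p.1 ^+ n * y))) /=; last first.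
  (* The inverse map: if h = r l^(n-1) x and k = r l^n y, then k x / (y h) recovers l, and h then
     gives r. *)
  exists (fun p : F * F => let l := (p.2 * x) / (y * p.1) in (l, p.1 / (x * l ^+ n.-1))).
    move=> [l r]; rewrite inE /= !mulf_eq0 !negb_or => /andP[/andP[/andP[r0 l1] _] /andP[/andP[_ l2] _]].
    have E : l ^+ n = l * l ^+ n.-1 by rewrite -exprS prednK.
    have l0 : l != 0 by apply: contraNneq l2 => ->; rewrite expr0n; case: (n) n0.
    have -> : r * l ^+ n * y * x / (y * (r * l ^+ n.-1 * x)) = l.
      by rewrite E; field; rewrite l1 x0 r0 y0.
    by congr pair; field; rewrite l1 x0.
  move=> [h k] /=; rewrite inE /= => /andP[h0 k0].
  set l := k * x / (y * h); have l0 : l != 0 by rewrite /l mulf_neq0 ?invr_eq0 ?mulf_neq0.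
  have l1 : l ^+ n.-1 != 0 by rewrite expf_neq0.
  have E : l ^+ n = l * l ^+ n.-1 by rewrite -exprS prednK.
  congr pair; first by field; rewrite l1.
  rewrite E.
  have -> : h / (x * l ^+ n.-1) * (l * l ^+ n.-1) * y = h / x * l * y by field; rewrite ?x0 ?l1.
  by rewrite /l; field; rewrite ?h0 ?x0 ?y0.
transitivity (\sum_(l : F | l != 0) \sum_(r : F | r != 0) corr g (r * x, r * y)).
  by rewrite sumr_const mulr_natl -(cardC1 (0 : F)).
rewrite (pair_big _ _ (fun l r => corr g (r * x, r * y))) /=; apply: eq_big => [[l r]|[l r] /andP[/= l0 r0]] /=.
  rewrite !mulf_eq0 !negb_or x0 y0 !andbT /=.
  have [->|l0] := eqVneq l 0; first by rewrite [0 ^+ n]expr0n eqn0Ngt n0 /= eqxx !andbF.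
  by rewrite !expf_neq0 // !andbT andbb.
rewrite -(corr_homog (n := n) (l := l)) //=.
by congr (corr g (_, _)); rewrite mulrCA mulrA.
Qed.

(** If d lies on an axis, the ray is that axis without 0, and its correlations sum to at most a
    second moment of rows or columns. Otherwise [corr_ray_generic] turns the sum over the ray into
    an average over all shifts with nonzero coordinates, and the sum over all shifts is the square
    of the sum of g, bounded by Cauchy-Schwarz from the row moment. *)
Lemma corr_ray (F : finFieldType) (g : F * F -> int) n (C : nat) (d : F * F) : (0 < n)%N ->
  (forall (l : F) x, l != 0 -> g (l ^+ n.-1 * x.1, l ^+ n * x.2) = g x) ->
  (forall x, g x ^+ 2 <= 1) ->
  \sum_a (\sum_b g (a, b)) ^+ 2 <= C%:R * #|F|%:R ^+ 2 ->
  \sum_b (\sum_a g (a, b)) ^+ 2 <= C%:R * #|F|%:R ^+ 2 ->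
  d != 0 ->
  \sum_(r | r != 0) corr g (r * d.1, r * d.2) <= (2 * C.+1)%:R * #|F|%:R ^+ 2.
Proof.
move=> n0 H g1 row col; case: d => x y d0 /=.
have c1 : (1 < #|F|)%N by exact: finNzRing_gt1.
have corr00 : 0 <= corr g 0 by rewrite /corr sumr_ge0 // => p _; rewrite addr0 -expr2 sqr_ge0.
have W : C%:R * #|F|%:R ^+ 2 <= (2 * C.+1)%:R * #|F|%:R ^+ 2 :> int.
  by rewrite ler_wpM2r ?exprn_ge0 ?ler0n // ler_nat; lia.
have [x0|x0] := eqVneq x 0.
  have y0 : y != 0 by apply: contraNneq d0 => ->; rewrite x0.
  apply: le_trans W; apply: le_trans row; rewrite -sum_corr_row [leRHS](bigD1 0) //=.
  apply: ler_wpDl => //; rewrite [leRHS](reindex (fun r => r * y)) /=; last first.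
    by exists (fun x => x / y) => z _; rewrite ?mulfK ?mulfVK.
  rewrite le_eqVlt; apply/orP; left; apply/eqP; apply: eq_big => r.
    by rewrite mulf_eq0 negb_or y0 andbT.
  by rewrite x0 mulr0.
have [y0|y0] := eqVneq y 0.
  apply: le_trans W; apply: le_trans col; rewrite -sum_corr_col [leRHS](bigD1 0) //=.
  apply: ler_wpDl => //; rewrite [leRHS](reindex (fun r => r * x)) /=; last first.
    by exists (fun z => z / x) => z _; rewrite ?mulfK ?mulfVK.
  rewrite le_eqVlt; apply/orP; left; apply/eqP; apply: eq_big => r.
    by rewrite mulf_eq0 negb_or x0 andbT.
  by rewrite y0 mulr0.
have := corr_ray_generic n0 H x0 y0; set S := \sum_(r | r != 0) corr g (r * x, r * y); move=> E.
(* Inclusion-exclusion: the two axes that are removed have nonnegative sums, and the origin, removed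
   twice, is put back at a cost of |F|^2. *)
have T : \sum_(h | h != 0) \sum_(k | k != 0) corr g (h, k) <= (\sum_p g p) ^+ 2 + #|F|%:R ^+ 2.
  have r0 : 0 <= \sum_k corr g (0, k) by rewrite sum_corr_row sumr_ge0 // => a _; exact: sqr_ge0.
  have k0 : 0 <= \sum_h corr g (h, 0) by rewrite sum_corr_col sumr_ge0 // => a _; exact: sqr_ge0.
  have z0 : corr g (0, 0) <= #|F|%:R ^+ 2.
    by rewrite -natrX -mulnn -card_prod; exact: corr0_le.
  rewrite (bigD1 0) //= in k0.
  rewrite -sum_corr sum_pair [X in _ <= X + _](bigD1 0) //=.
  rewrite [X in _ <= (_ + X) + _](_ : _ = \sum_(h | h != 0) corr g (h, 0)
    + \sum_(h | h != 0) \sum_(k | k != 0) corr g (h, k)); last first.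
    by rewrite -big_split /=; apply: eq_bigr => h _; rewrite (bigD1 0).
  lra.
have G : (\sum_p g p) ^+ 2 <= #|F|%:R * (C%:R * #|F|%:R ^+ 2).
  by rewrite sum_pair; apply: le_trans (sqr_sum_le _) _; rewrite ler_wpM2l ?ler0n.
move: T; rewrite -E => T.
have {E} : #|F|.-1%:R * S <= #|F|%:R * (C%:R * #|F|%:R ^+ 2) + #|F|%:R ^+ 2.
  by apply: le_trans T _; rewrite lerD2r.
have -> : (#|F|%:R : int) = #|F|.-1%:R + 1 by rewrite natr1 prednK // ltnW.
have : 1 <= (#|F|.-1%:R : int) by rewrite ler1n; case: #|F| c1 => [|[|]].
have -> : (2 * C.+1)%:R = 2 * (C%:R + 1) :> int by rewrite natrM -[C.+1]addn1 natrD.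
have : 0 <= (C%:R : int) by [].
move: (#|F|.-1%:R : int) (C%:R : int) => p c c0 p1 B.
have [S0|S0] := leP S 0.
  by apply: le_trans S0 _; rewrite mulr_ge0 ?exprn_ge0 //; lra.
have p0 : 0 < p + 1 by lra.
rewrite -(ler_pM2l p0).
(* Here p = |F| - 1 >= 1, so replacing the factor |F| - 1 by |F| costs at most a factor 2. *)
have : (p + 1) * S <= 2 * (p * S).
  by rewrite mulrA ler_pM2r //; lra.
move/le_trans; apply.
have -> : (p + 1) * (2 * (c + 1) * (p + 1) ^+ 2) =
  2 * ((p + 1) * (c * (p + 1) ^+ 2) + (p + 1) ^+ 2) + 2 * p * (p + 1) ^+ 2 by ring.
have : 0 <= 2 * p * (p + 1) ^+ 2 by rewrite mulr_ge0 ?exprn_ge0 //; lra.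
lra.
Qed.

(** * Bilinear splitting and grids *)

(** The quantity Q(l,r), with [u] and [v] the reductions of the box modulo l and r: a fibre of [v]
    is then a grid of step r, and k is its moving base point. *)
Definition fiberQ (V W : finZmodType) (I : finType) (u : I -> V) (v : I -> W) (g : V -> int) : int :=
  \sum_(m : W) \sum_(k : V) (\sum_(i | v i == m) g (k + u i)) ^+ 2.

(* For each (i, j), exactly one (m, k) has v i = m and u j = k, and replacing u j by k in the first
   factor and v i by m in the second one decouples i from j. *)
Lemma bilinear_split (V W : finZmodType) (I : finType) (u : I -> V) (v : I -> W)
    (gV : V -> int) (gW : W -> int) (cV : V) (cW : W) :
  (\sum_i \sum_j gV (cV + u i + u j) * gW (cW + v i + v j)) *+ 2 <=
  fiberQ u v gV + fiberQ v u gW.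
Proof.
pose X m k := \sum_(i | v i == m) gV (cV + k + u i).
pose Y m k := \sum_(j | u j == k) gW (cW + m + v j).
have -> : \sum_i \sum_j gV (cV + u i + u j) * gW (cW + v i + v j) =
  \sum_m \sum_k X m k * Y m k.
  rewrite (partition_big v xpredT) //=; apply: eq_bigr => m _.
  transitivity (\sum_(i | v i == m) \sum_k \sum_(j | u j == k)
      gV (cV + k + u i) * gW (cW + m + v j)).
    apply: eq_bigr => i /eqP <-; rewrite (partition_big u xpredT) //=.
    by apply: eq_bigr => k _; apply: eq_bigr => j /eqP <-; rewrite (addrAC cV).
  rewrite exchange_big /=; apply: eq_bigr => k _.
  by rewrite /X mulr_suml; apply: eq_bigr => i _; rewrite mulr_sumr.
have -> : fiberQ u v gV = \sum_m \sum_k X m k ^+ 2.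
  apply: eq_bigr => m _; rewrite -(sum_shift _ cV); apply: eq_bigr => k _.
  by congr (_ ^+ 2); apply: eq_bigr.
have -> : fiberQ v u gW = \sum_m \sum_k Y m k ^+ 2.
  rewrite [RHS]exchange_big; apply: eq_bigr => k _; rewrite -(sum_shift _ cW).
  by apply: eq_bigr => m _; congr (_ ^+ 2); apply: eq_bigr.
rewrite -big_split -sumrMnl; apply: ler_sum => m _.
rewrite -big_split -sumrMnl; apply: ler_sum => k _ /=.
have := sqr_ge0 (X m k - Y m k); rewrite sqrrB; lia.
Qed.

Lemma fiberQ_scale (V W : finZmodType) (I : finType) (u : I -> V) (v : I -> W)
    (g : V -> int) (e : int) : e ^+ 2 <= 1 ->
  fiberQ u v (fun x => e * g x) <= fiberQ u v g.
Proof.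
move=> e1; apply: ler_sum => m _; apply: ler_sum => k _.
rewrite -mulr_sumr exprMn ler_piMl ?sqr_ge0 //.
Qed.

(** The step [r] is a field element, so that it can later range over all of the field; step 1 gives
    the reduction of the box itself. *)
Definition grid (F : finFieldType) (r : F) (J1 J2 : nat) (j : 'I_J1 * 'I_J2) : F * F :=
  (r * (val j.1)%:R, r * (val j.2)%:R).

Definition gridN (F : finFieldType) (g : F * F -> int) (r : F) (J1 J2 : nat) : int :=
  \sum_x (\sum_(j : 'I_J1 * 'I_J2) g (x + grid r j)) ^+ 2.

Lemma gridN_ge0 (F : finFieldType) (g : F * F -> int) r J1 J2 : 0 <= gridN g r J1 J2.
Proof. by apply: sumr_ge0 => x _; exact: sqr_ge0. Qed.

Lemma sum_sqr_sub_le (V : finZmodType) (A B C : V -> int) (c : V) :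
  (forall x, B x = A x + C (c + x)) ->
  \sum_x A x ^+ 2 <= 2 * \sum_x B x ^+ 2 + 2 * \sum_x C x ^+ 2.
Proof.
move=> E; rewrite -(sum_shift (fun x => C x ^+ 2) c) !mulr_sumr -big_split.
apply: ler_sum => x _ /=; rewrite E.
have := sqr_ge0 (A x + 2 * C (c + x)); lia.
Qed.

(** A grid of length J is a grid of length J + K minus a translate of one of length K, and
    translating does not change the sum over base points. *)
Lemma gridN_split1 (F : finFieldType) (g : F * F -> int) r J K J2 :
  gridN g r J J2 <= 2 * gridN g r (J + K) J2 + 2 * gridN g r K J2.
Proof.
apply: (@sum_sqr_sub_le _ _ _ _ (r * J%:R, 0)) => x.
rewrite !sum_pair /= big_split_ord /=; congr (_ + _).
apply: eq_bigr => j1 _; apply: eq_bigr => j2 _; congr g.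
by case: x => a b; congr pair; rewrite /= ?natrD; ring.
Qed.

Lemma gridN_split2 (F : finFieldType) (g : F * F -> int) r J1 J K :
  gridN g r J1 J <= 2 * gridN g r J1 (J + K) + 2 * gridN g r J1 K.
Proof.
apply: (@sum_sqr_sub_le _ _ _ _ (0, r * J%:R)) => x.
rewrite !sum_pair /= -big_split; apply: eq_bigr => j1 _ /=.
rewrite big_split_ord /=; congr (_ + _).
apply: eq_bigr => j2 _; congr g.
by case: x => a b; congr pair; rewrite /= ?natrD; ring.
Qed.

(* The bound for one box is replaced by an average over box sizes that does not depend on J; this is
   what allows the later sum over the step of the grid, as J varies with the step. *)
Lemma average_bound (N : nat -> int) (J K : nat) : (J <= K)%N ->
  (forall i, 0 <= N i) -> (forall i, N J <= 2 * N (J + i)%N + 2 * N i) ->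
  K%:R * N J <= 4 * \sum_(i < 2 * K) N i.
Proof.
move=> JK N0 H.
have -> : K%:R * N J = \sum_(i < K) N J by rewrite sumr_const card_ord mulr_natl.
apply: le_trans (ler_sum _ (fun (i : 'I_K) _ => H i)) _.
rewrite big_split -!mulr_sumr /=.
have E m k : (k <= m)%N -> \sum_(i < k) N i <= \sum_(i < m) N i.
  move=> km; rewrite -(subnKC km) big_split_ord /= lerDl; exact: sumr_ge0.
have E2 : \sum_(i < K) N (J + i)%N <= \sum_(i < 2 * K) N i.
  apply: (le_trans _ (E (2 * K)%N (J + K)%N _)); last by lia.
  by rewrite big_split_ord /= lerDr sumr_ge0.
have E1 : \sum_(i < K) N i <= \sum_(i < 2 * K) N i by apply: E; lia.
lra.
Qed.

Lemma gridN_average (F : finFieldType) (g : F * F -> int) r J1 J2 K1 K2 :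
  (J1 <= K1)%N -> (J2 <= K2)%N ->
  K1%:R * K2%:R * gridN g r J1 J2 <=
  16 * \sum_(i < 2 * K1) \sum_(j < 2 * K2) gridN g r i j.
Proof.
move=> h1 h2.
have A1 : K1%:R * gridN g r J1 J2 <= 4 * \sum_(i < 2 * K1) gridN g r i J2.
  apply: (average_bound (N := fun i => gridN g r i J2)) => // i.
    exact: gridN_ge0.
  exact: gridN_split1.
have A2 i : K2%:R * gridN g r i J2 <= 4 * \sum_(j < 2 * K2) gridN g r i j.
  apply: (average_bound (N := fun j => gridN g r i j)) => // j.
    exact: gridN_ge0.
  exact: gridN_split2.
rewrite mulrAC mulrC.
apply: le_trans (ler_wpM2l (ler0n _ _) A1) _.
have -> : (16 : int) = 4 * 4 by [].
rewrite mulrCA -mulrA ler_pM2l // !mulr_sumr.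
by apply: ler_sum => i _; exact: A2.
Qed.

(** * Arithmetic progressions and residue classes *)

Lemma sum_progression (r H m : nat) (g : nat -> int) : (m < r)%N ->
  \sum_(i < H | (i %% r == m)%N) g i = \sum_(j < (H + (r.-1 - m)) %/ r) g (m + r * j)%N.
Proof.
move=> mr; elim: H => [|H IH].
  by rewrite !big_ord0 divn_small ?big_ord0 //; lia.
rewrite big_mkcond big_ord_recr -big_mkcond /= IH.
have r0 : (0 < r)%N by lia.
have eH := divn_eq H r; have lH := ltn_pmod H r0.
move: (H %/ r)%N (H %% r)%N eH lH => a b eH lH {IH}.
have D c : (a * r + c + (r.-1 - m) = a * r + (c + (r.-1 - m)))%N by lia.
have J c k : (c + (r.-1 - m) = k)%N -> ((a * r + c + (r.-1 - m)) %/ r = a + k %/ r)%N.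
  by move=> <-; rewrite -addnA divnMDl.
have <- : (a * r + b.+1 = H.+1)%N by lia.
rewrite -!(big_mkord xpredT (fun j => g (m + r * j)%N)) {1}eH (J _ _ erefl) (J _ _ erefl).
(* With b the residue of H, the length, which is the ceiling of (H - m) / r, grows from H to H + 1
   exactly when b = m. *)
case: (ltngtP b m) => bm.
- by rewrite addr0 !divn_small //; lia.
- rewrite addr0 (_ : (b + _ = r + (b - m).-1)%N); last by lia.
  rewrite (_ : (b.+1 + _ = r + (b - m))%N); last by lia.
  by rewrite !divnDl // !divnn r0 !divn_small //; lia.
rewrite bm divn_small ?addn0; last by lia.
rewrite (_ : (m.+1 + _ = r)%N); last by lia.
by rewrite divnn r0 addn1 big_nat_recr //=; congr (_ + g _); lia.
Qed.

Lemma count_modn (p m J : nat) : (m < p)%N ->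
  (count (fun j => (j %% p == m)%N) (iota 0 J) <= J %/ p + 1)%N.
Proof.
move=> mp; rewrite -sum1_count -(subn0 J) -/(index_iota 0 J) subn0 big_mkord.
have -> : (\sum_(i < J | i %% p == m) 1 = (J + (p.-1 - m)) %/ p)%N.
  apply/eqP; rewrite -(eqr_nat int) natr_sum (sum_progression J (fun=> 1%:R) mp).
  by rewrite sumr_const card_ord.
have p0 : (0 < p)%N by lia.
have -> : (J %/ p + 1 = (J + p) %/ p)%N by rewrite divnDr ?dvdnn // divnn p0.
by rewrite leq_div2r //; lia.
Qed.

Lemma natr_Fp_eq (p j : nat) (x : 'F_p) : prime p -> (j%:R == x) = (j %% p == val x)%N.
Proof. by move=> pp; rewrite -val_eqE /= val_Fp_nat. Qed.

Lemma ltn_Fp (p : nat) (x : 'F_p) : prime p -> (val x < p)%N.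
Proof. by move=> pp; rewrite -[X in (_ < X)%N](Fp_cast pp) ltn_ord. Qed.

Lemma count_residue (p : nat) (x : 'F_p) (J : nat) : prime p ->
  (count (fun j => j%:R == x) (iota 0 J) <= J %/ p + 1)%N.
Proof.
move=> pp; rewrite (eq_count (fun j => natr_Fp_eq j x pp)) count_modn //.
exact: ltn_Fp.
Qed.

Lemma sum_residue (p : nat) (x : 'F_p) (J : nat) : prime p ->
  \sum_(j < J) (j%:R == x)%:R <= (J %/ p + 1)%:R :> int.
Proof.
move=> pp; rewrite -natr_sum ler_nat; apply: leq_trans (count_residue x J pp).
by rewrite -sumn_count sumnE big_map -[X in iota 0 X]subn0 -/(index_iota 0 J) big_mkord.
Qed.

(** The positivity step: each nonzero class modulo p is hit at most k + 1 times, and classes that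
    are not hit can be added since f is nonnegative. *)
Lemma sum_over_residues (p k : nat) (P : seq nat) (f : 'F_p -> int) : prime p ->
  (forall x, 0 <= f x) -> uniq P -> (forall r, r \in P -> (r < k * p)%N) ->
  \sum_(r <- P | r%:R != 0 :> 'F_p) f r%:R <= k.+1%:R * \sum_(x | x != 0) f x.
Proof.
move=> pp f0 uP HP.
rewrite (partition_big (fun r => r%:R : 'F_p) (fun x => x != 0)) //= mulr_sumr.
apply: ler_sum => x x0.
rewrite (eq_bigr (fun=> f x)); last by move=> r /andP[_ /eqP ->].
rewrite -big_filter big_const_seq count_predT iter_addr_0 -[X in X <= _]mulr_natl.
apply: ler_wpM2r => //; rewrite ler_nat.
apply: leq_trans (_ : (count (fun r => r%:R == x) (iota 0 (k * p)) <= _)%N).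
  rewrite -size_filter; apply: uniq_leq_size; first exact: filter_uniq.
  move=> r; rewrite !mem_filter => /andP[/andP[_ ->] rP] /=.
  by rewrite mem_iota /= add0n HP.
by apply: leq_trans (count_residue _ _ pp) _; rewrite mulnK ?prime_gt0 // addn1.
Qed.

(** * Grid sums summed over the step *)

Lemma gridN_corr (F : finFieldType) (g : F * F -> int) r J1 J2 :
  gridN g r J1 J2 = \sum_(i : 'I_J1 * 'I_J2) \sum_(j : 'I_J1 * 'I_J2)
    corr g (r * (j.1%:R - i.1%:R), r * (j.2%:R - i.2%:R)).
Proof.
rewrite /gridN; under eq_bigr => x _ do rewrite expr2 big_distrlr /=.
rewrite exchange_big /=; apply: eq_bigr => i _.
rewrite exchange_big /=; apply: eq_bigr => j _.
rewrite -(sum_shift _ (- grid r i)); apply: eq_bigr => x _.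
by congr (g _ * g _); rewrite /grid; case: x => a b; congr pair; rewrite /=; ring.
Qed.

(** Two grid points that agree modulo p have correlation at most p^2 for each of at most p steps,
    which gives p^3; a point has at most (J1/p + 1)(J2/p + 1) such partners. For every other pair
    the sum over steps runs along a ray. *)
Lemma sum_gridN (p : nat) (g : 'F_p * 'F_p -> int) (K J1 J2 : nat) : prime p ->
  (forall x, g x ^+ 2 <= 1) ->
  (forall d, d != 0 -> \sum_(r | r != 0) corr g (r * d.1, r * d.2) <= K%:R * p%:R ^+ 2) ->
  \sum_(r | r != 0) gridN g r J1 J2 <=
  (J1 * J2)%:R * (p%:R ^+ 3 * ((J1 %/ p + 1)%:R * (J2 %/ p + 1)%:R)
                 + K%:R * p%:R ^+ 2 * (J1 * J2)%:R).
Proof.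
move=> pp g1 H.
under eq_bigr => r _ do rewrite gridN_corr.
rewrite exchange_big /=.
have -> : (J1 * J2)%:R * (p%:R ^+ 3 * ((J1 %/ p + 1)%:R * (J2 %/ p + 1)%:R)
                 + K%:R * p%:R ^+ 2 * (J1 * J2)%:R)
  = \sum_(i : 'I_J1 * 'I_J2) (p%:R ^+ 3 * ((J1 %/ p + 1)%:R * (J2 %/ p + 1)%:R)
                 + K%:R * p%:R ^+ 2 * (J1 * J2)%:R) :> int.
  by rewrite sumr_const card_prod !card_ord mulr_natl.
apply: ler_sum => i _; rewrite exchange_big /=.
apply: (@le_trans _ _ (\sum_(j : 'I_J1 * 'I_J2)
   (p%:R ^+ 3 * ((j.1%:R == i.1%:R :> 'F_p)%:R * (j.2%:R == i.2%:R :> 'F_p)%:R)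
     + K%:R * p%:R ^+ 2))).
  apply: ler_sum => j _.
  set d : 'F_p * 'F_p := (j.1%:R - i.1%:R, j.2%:R - i.2%:R).
  have Kp : 0 <= K%:R * p%:R ^+ 2 :> int by rewrite mulr_ge0 ?exprn_ge0.
  have [E|d0] := eqVneq d 0; last first.
    apply: le_trans (H d d0) _; rewrite lerDr mulr_ge0 ?exprn_ge0 // mulr_ge0 //.
  have E1 : j.1%:R = i.1%:R :> 'F_p by apply: subr0_eq; exact: (congr1 fst E).
  have E2 : j.2%:R = i.2%:R :> 'F_p by apply: subr0_eq; exact: (congr1 snd E).
  rewrite E1 E2 !eqxx !mulr1 !subrr.
  apply: ler_wpDr => //.
  apply: (@le_trans _ _ (\sum_(r : 'F_p | r != 0) p%:R ^+ 2)).
    apply: ler_sum => r _; rewrite mulr0; apply: le_trans (corr0_le g1) _.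
    by rewrite card_prod card_Fp // natrM -expr2.
  rewrite sumr_const -[leLHS]mulr_natl (exprS _ 2); apply: ler_wpM2r; first exact: exprn_ge0.
  by rewrite ler_nat -[leqRHS](card_Fp pp) max_card.
rewrite big_split /= -mulr_sumr sumr_const card_prod !card_ord.
rewrite -[X in _ + X <= _]mulr_natr lerD2r.
apply: ler_wpM2l; first exact: exprn_ge0.
rewrite sum_pair /= -big_distrlr /=.
apply: ler_pM; try (by apply: sumr_ge0); exact: sum_residue.
Qed.

Lemma sum_progression2 (r H1 H2 m1 m2 : nat) (h : nat -> nat -> int) :
  (m1 < r)%N -> (m2 < r)%N ->
  \sum_(i : 'I_H1 * 'I_H2 | (i.1 %% r == m1)%N && (i.2 %% r == m2)%N) h i.1 i.2 =
  \sum_(j : 'I_((H1 + (r.-1 - m1)) %/ r) * 'I_((H2 + (r.-1 - m2)) %/ r))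
     h (m1 + r * j.1)%N (m2 + r * j.2)%N.
Proof.
move=> h1 h2.
rewrite -(pair_big (fun i : 'I_H1 => i %% r == m1)%N (fun i : 'I_H2 => i %% r == m2)%N
  (fun i j => h i j)) /=.
rewrite (sum_progression H1 (fun i => \sum_(j < H2 | (j %% r == m2)%N) h i j) h1).
rewrite -(pair_bigA _ (fun (i : 'I_((H1 + (r.-1 - m1)) %/ r)) (j : 'I_((H2 + (r.-1 - m2)) %/ r)) =>
  h (m1 + r * i)%N (m2 + r * j)%N)) /=.
by apply: eq_bigr => i _; rewrite (sum_progression H2 (h _) h2).
Qed.

Lemma card_ltn_Fp (r H : nat) : prime r -> (#|[pred m : 'F_r | (val m < H)%N]| <= minn r H)%N.
Proof.
move=> pr; rewrite leq_min; apply/andP; split.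
  by rewrite -[leqRHS](card_Fp pr) max_card.
rewrite cardE -(size_map val).
rewrite -[leqRHS](size_iota 0 H); apply: uniq_leq_size.
  by rewrite map_inj_uniq ?enum_uniq //; exact: val_inj.
by move=> x /mapP[y yH ->]; move: yH; rewrite mem_enum inE mem_iota /= add0n.
Qed.

(** The indices of the box in one residue class modulo r form a grid of step r whose lengths depend
    on the class; [gridN_average] replaces it by an average over lengths that does not. The factor
    with [minn] counts the nonempty classes. *)
Lemma fiberQ_le (p r : nat) (g : 'F_p * 'F_p -> int) (H1 H2 K1 K2 : nat) :
  prime r -> (H1 %/ r < K1)%N -> (H2 %/ r < K2)%N ->
  K1%:R * K2%:R * fiberQ (@grid 'F_p 1 H1 H2) (@grid 'F_r 1 H1 H2) g <=
  (minn r H1 * minn r H2)%:R *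
  (16 * \sum_(i < 2 * K1) \sum_(j < 2 * K2) gridN g r%:R i j).
Proof.
move=> pr hK1 hK2; set G := 16 * _.
have r0 := prime_gt0 pr.
pose ok (m : 'F_r * 'F_r) := ((val m.1 < H1) && (val m.2 < H2))%N.
pose N (m : 'F_r * 'F_r) :=
  \sum_k (\sum_(i : 'I_H1 * 'I_H2 | grid 1 i == m) g (k + grid 1 i)) ^+ 2.
have G0 : 0 <= G.
  by rewrite mulr_ge0 // sumr_ge0 // => i _; apply: sumr_ge0 => j _; exact: gridN_ge0.
have NG m : K1%:R * K2%:R * N m <= (ok m)%:R * G.
  case: m => m1 m2; rewrite /N /ok /=.
  have m1r := ltn_Fp m1 pr; have m2r := ltn_Fp m2 pr.
  have idx (i : 'I_H1 * 'I_H2) :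
      (grid 1 i == (m1, m2)) = (i.1 %% r == val m1)%N && (i.2 %% r == val m2)%N.
    by rewrite /grid xpair_eqE !mul1r !natr_Fp_eq.
  case: (boolP (_ && _)) => [ok_m|nok].
    pose J H (m : 'F_r) := ((H + (r.-1 - val m)) %/ r)%N.
    have JH H m : (J H m <= H %/ r + 1)%N.
      have -> : (H %/ r + 1 = (H + r) %/ r)%N by rewrite divnDr ?dvdnn // divnn r0.
      by rewrite leq_div2r //; lia.
    have -> : \sum_k (\sum_(i : 'I_H1 * 'I_H2 | grid 1 i == (m1, m2)) g (k + grid 1 i)) ^+ 2 =
        gridN g r%:R (J H1 m1) (J H2 m2).
      rewrite /gridN -[RHS](sum_shift _ ((val m1)%:R, (val m2)%:R)).
      apply: eq_bigr => k _; congr (_ ^+ 2).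
      rewrite (eq_bigl _ _ idx).
      rewrite (sum_progression2 H1 H2 (fun i j => g (k + (1 * i%:R, 1 * j%:R))) m1r m2r).
      apply: eq_bigr => j _; congr g; case: k => k1 k2; congr pair; rewrite /= natrD natrM; ring.
    rewrite mul1r; apply: gridN_average; first by have := JH H1 m1; lia.
    by have := JH H2 m2; lia.
  rewrite mul0r big1 ?mulr0 // => k _; rewrite big1 ?expr0n // => i; rewrite idx => /andP[/eqP e1 /eqP e2].
  case/negP: nok; rewrite -e1 -e2.
  by rewrite !(leq_ltn_trans (leq_mod _ _)).
rewrite /fiberQ mulr_sumr; apply: le_trans (ler_sum _ (fun m _ => NG m)) _.
rewrite -mulr_suml; apply: ler_wpM2r => //.
rewrite -natr_sum ler_nat.
have -> : (\sum_m ok m = #|[pred m : 'F_r | (val m < H1)%N]| * #|[pred m : 'F_r | (val m < H2)%N]|)%N.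
  rewrite -!sum1_card big_distrlr /= [LHS]big_mkcond /= pair_big /= [RHS]big_mkcond /=.
  by apply: eq_bigr => m _; rewrite /ok; case: ifP.
by apply: leq_mul; exact: card_ltn_Fp.
Qed.

(** * The square sieve *)

Lemma ler_sum_subset (T : eqType) (s1 s2 : seq T) (f : T -> int) :
  uniq s1 -> uniq s2 -> {subset s1 <= s2} -> (forall x, 0 <= f x) ->
  \sum_(x <- s1) f x <= \sum_(x <- s2) f x.
Proof.
move=> u1 u2 s12 f0.
have pE : perm_eq s1 [seq x <- s2 | x \in s1].
  apply: uniq_perm => //; first exact: filter_uniq.
  by move=> x; rewrite mem_filter; case: (boolP (x \in s1)) => // /s12.
by rewrite (perm_big _ pE) big_filter big_mkcond; apply: ler_sum => x _; case: ifP.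
Qed.

Lemma ler_sum_box (S : seq (nat * nat)) (A B : nat) (f : nat -> nat -> int) :
  uniq S -> (forall e, e \in S -> (e.1 < A) && (e.2 < B))%N ->
  (forall i j, 0 <= f i j) ->
  \sum_(e <- S) f e.1 e.2 <= \sum_(i < A) \sum_(j < B) f i j.
Proof.
move=> uS HS f0.
have -> : \sum_(i < A) \sum_(j < B) f i j =
    \sum_(e <- [seq (i, j) | i <- iota 0 A, j <- iota 0 B]) f e.1 e.2.
  rewrite big_allpairs_dep /= -(big_mkord xpredT (fun i => \sum_(j < B) f i j)) /index_iota subn0.
  by apply: eq_bigr => i _; rewrite -(big_mkord xpredT (f i)) /index_iota subn0.
apply: (ler_sum_subset (f := fun e => f e.1 e.2)) => // [|[i j] /HS /= /andP[iA jB]].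
  by rewrite allpairs_uniq ?iota_uniq // => -[? ?] [? ?].
by apply/allpairsP; exists (i, j); rewrite !mem_iota.
Qed.

Lemma sum_iota_shift (m k : nat) (f : nat -> int) :
  \sum_(x <- iota m k) f x = \sum_(i < k) f (m + i)%N.
Proof.
rewrite -{1}(addn0 m) iotaDl big_map -(big_mkord xpredT (fun i => f (m + i)%N)).
by rewrite /index_iota subn0.
Qed.

(** The interval [A, 2A) lies in [j, j + 2A) for each j < A. This replaces one variable by a sum of
    two independent ones, the shape that [bilinear_split] needs. *)
Lemma window_sum (A : nat) (f : nat -> int) : (forall i, 0 <= f i) ->
  A%:R * \sum_(e < A) f (A + e)%N <= \sum_(j < 2 * A) \sum_(i < 2 * A) f (j + i)%N.
Proof.
move=> f0.
have -> : A%:R * \sum_(e < A) f (A + e)%N = \sum_(j < A) \sum_(e < A) f (A + e)%N.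
  by rewrite sumr_const card_ord mulr_natl.
rewrite [leRHS](_ : _ = \sum_(j < A + A) \sum_(i < 2 * A) f (j + i)%N); last first.
  by rewrite addnn -mul2n.
rewrite [leRHS]big_split_ord /=.
apply: ler_wpDr; first by apply: sumr_ge0 => j _; apply: sumr_ge0.
apply: ler_sum => j _; rewrite -!sum_iota_shift.
apply: ler_sum_subset => //; try exact: iota_uniq.
by move=> x; rewrite !mem_iota; have := ltn_ord j; lia.
Qed.

Lemma window_sum2 (A B : nat) (f : nat -> nat -> int) : (forall i j, 0 <= f i j) ->
  A%:R * B%:R * \sum_(e1 < A) \sum_(e2 < B) f (A + e1)%N (B + e2)%N <=
  \sum_(i : 'I_(2 * A) * 'I_(2 * B)) \sum_(j : 'I_(2 * A) * 'I_(2 * B))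
     f (i.1 + j.1)%N (i.2 + j.2)%N.
Proof.
move=> f0.
rewrite sum_pair /=.
have -> : \sum_(a < 2 * A) \sum_(b < 2 * B) \sum_(j : 'I_(2 * A) * 'I_(2 * B))
    f (a + j.1)%N (b + j.2)%N = \sum_(a < 2 * A) \sum_(a' < 2 * A)
    \sum_(b < 2 * B) \sum_(b' < 2 * B) f (a + a')%N (b + b')%N.
  apply: eq_bigr => a _; rewrite [RHS]exchange_big /=.
  by apply: eq_bigr => b _; rewrite sum_pair.
pose h x := \sum_(b < 2 * B) \sum_(b' < 2 * B) f x (b + b')%N.
have h0 x : 0 <= h x by apply: sumr_ge0 => b _; apply: sumr_ge0.
apply: le_trans (window_sum A h0).
rewrite -mulrA; apply: ler_wpM2l; first exact: ler0n.
by rewrite mulr_sumr; apply: ler_sum => e _; exact: window_sum.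
Qed.

Lemma card_disc0 (F : finFieldType) (n : nat) (y : F) : (0 < n)%N ->
  n.-1%:R != 0 :> F -> (#|[pred x : F | (disc n (x, y) == 0)%R]| <= n)%N.
Proof.
move=> n0 c1.
have {}c1 : (n.-1%:R : F) ^+ n.-1 != 0 by rewrite expf_neq0.
apply: leq_trans (card_exp_fiber (- (n%:R ^+ n * y ^+ n.-1) / n.-1%:R ^+ n.-1) n0).
apply: subset_leq_card; apply/subsetP => x; rewrite !inE /disc /= => E.
apply/eqP; apply: (mulfI c1); rewrite [RHS]mulrC mulfVK //.
by apply/eqP; rewrite -addr_eq0.
Qed.

Lemma count_disc0 (n p A c : nat) (y : 'F_p) : prime p -> (0 < n)%N ->
  n.-1%:R != 0 :> 'F_p ->
  \sum_(e < A) (disc n ((c + e)%:R, y) == 0)%:R <= (n * (A %/ p + 1))%:R :> int.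
Proof.
move=> pp n0 c1.
apply: (@le_trans _ _ (\sum_(x | disc n (x, y) == 0) \sum_(e < A) (e%:R == x - c%:R)%:R)).
  rewrite exchange_big /=; apply: ler_sum => e _.
  case: eqVneq => [E|_]; last by apply: sumr_ge0.
  rewrite (bigD1 (c + e)%:R) /=; last by rewrite E.
  by rewrite natrD addrAC subrr add0r eqxx lerDl sumr_ge0.
apply: (@le_trans _ _ (\sum_(x | disc n (x, y) == 0) (A %/ p + 1)%:R)).
  by apply: ler_sum => x _; exact: sum_residue.
rewrite sumr_const -[leLHS]mulr_natl -natrM ler_nat leq_mul2r card_disc0 ?orbT //.
Qed.

Lemma Fp_natr_neq0 (p m : nat) : prime p -> (0 < m < p)%N -> m%:R != 0 :> 'F_p.
Proof. by move=> pp /andP[m0 mp]; rewrite natr_Fp_eq // modn_small //= -lt0n. Qed.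

(** The constant of [corr_ray] for the moment bound n + 2 of [qdisc_row] and [qdisc_col]. *)
Definition disc_corr_const (n : nat) : nat := (2 * n.+3)%N.

Lemma qdisc_Fp_corr (n p : nat) (d : 'F_p * 'F_p) : odd n -> (1 < n)%N -> prime p -> (n < p)%N ->
  d != 0 ->
  \sum_(r | r != 0) corr (qdisc n) (r * d.1, r * d.2) <= (disc_corr_const n)%:R * p%:R ^+ 2.
Proof.
move=> on n1 pp np d0.
have oF : odd #|'F_p|.
  by rewrite card_Fp //; case: (even_prime pp) => // p2; move: np; rewrite p2; lia.
have c1 : n.-1%:R != 0 :> 'F_p by apply: Fp_natr_neq0 => //; lia.
have c2 : n%:R != 0 :> 'F_p by apply: Fp_natr_neq0 => //; lia.
have -> : p%:R = #|'F_p|%:R :> int by rewrite card_Fp.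
apply: (@corr_ray _ _ n n.+2) => //; first by lia.
- by move=> l x l0; exact: qdisc_homog.
- exact: qdisc_sqr_le1.
- exact: qdisc_row.
- exact: qdisc_col.
Qed.

(** The ratio 4 leaves room in Chebyshev's argument: 'C(4z, 2z) is 16^z up to a factor linear in z,
    while the primes up to z contribute little more than 4^z. *)
Definition in_window (z p : nat) := prime p && (z < p <= 4 * z)%N.

(** [K1] and [K2] serve all moduli r > z at once, which makes the averaged grid sum a function of r
    modulo l alone. The constant 80 is 16 from [gridN_average] times 5 from [sum_over_residues]; 64
    z^3 and 16 z^2 bound l^3 and l^2. *)
Lemma sum_fiberQ_le (n z H1 H2 l K1 K2 : nat) (P : seq nat) :
  odd n -> (1 < n)%N -> (n <= z)%N -> uniq P -> all (in_window z) P -> l \in P ->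
  K1 = (H1 %/ z + 1)%N -> K2 = (H2 %/ z + 1)%N ->
  \sum_(r <- P | r != l)
     fiberQ (@grid 'F_l 1 H1 H2) (@grid 'F_r 1 H1 H2) (qdisc n) <=
  ((minn (4 * z) H1 * minn (4 * z) H2) * (80 * (4 * (4 * K1 * K2 *
    (64 * z ^ 3 * ((2 * K1 %/ z + 1) * (2 * K2 %/ z + 1))
      + disc_corr_const n * (16 * z ^ 2) * (4 * K1 * K2))))))%:R.
Proof.
move=> on n1 nz uP /allP HP lP eK1 eK2.
have /andP[pl /andP[zl lz]] := HP _ lP.
have z0 : (0 < z)%N by lia.
set X := (_ + _ : nat)%N.
have K0 : (0 < K1 * K2)%N by rewrite eK1 eK2 !addn1.
have K0' : 0 < (K1 * K2)%:R :> int by rewrite ltr0n.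
rewrite -(ler_pM2l K0') -natrM.
have Hdiv H r : (z < r)%N -> (H %/ r < H %/ z + 1)%N.
  by move=> zr; rewrite addn1 ltnS; apply: leq_div2l => //; exact: ltnW.
pose N r := \sum_(i < 2 * K1) \sum_(j < 2 * K2) gridN (@qdisc 'F_l n) r i j.
have N0 r : 0 <= N r by apply: sumr_ge0 => i _; apply: sumr_ge0 => j _; exact: gridN_ge0.
have Q1 r : r \in P -> (K1 * K2)%:R *
    fiberQ (@grid 'F_l 1 H1 H2) (@grid 'F_r 1 H1 H2) (qdisc n) <=
    (minn (4 * z) H1 * minn (4 * z) H2)%:R * (16 * N r%:R).
  move=> rP; have /andP[pr /andP[zr rz]] := HP _ rP.
  rewrite natrM.
  apply: le_trans (fiberQ_le (K1 := K1) (K2 := K2) _ pr _ _) _; try by rewrite ?eK1 ?eK2 Hdiv.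
  apply: ler_wpM2r; first by rewrite mulr_ge0 ?N0.
  by rewrite ler_nat; apply: leq_mul; rewrite leq_min !geq_min ?leqnn ?orbT andbT; lia.
rewrite mulr_sumr big_seq_cond.
apply: le_trans (ler_sum _ (fun r rP => Q1 r (proj1 (andP rP)))) _.
rewrite -big_seq_cond -!mulr_sumr mulnCA [in leRHS]natrM; apply: ler_wpM2l; first exact: ler0n.
have S1 : \sum_(r <- P | r != l) N r%:R <= 5%:R * \sum_(x | x != 0) N x.
  (* The value 4 suffices because r <= 4z < 4l. *)
  apply: le_trans (sum_over_residues (k := 4) pl N0 uP _); last first.
    by move=> r /HP /andP[_ /andP[]]; lia.
  rewrite big_seq_cond [leRHS]big_seq_cond le_eqVlt; apply/orP; left; apply/eqP.
  apply: eq_bigl => r; case: (boolP (r \in P)) => //= rP.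
  have /andP[pr _] := HP _ rP.
  rewrite natr_Fp_eq // -/(dvdn l r) dvdn_prime2 // eq_sym //.
apply: (@le_trans _ _ (80 * \sum_(x | x != 0) N x)); first lra.
rewrite (mulnCA _ 80).
rewrite natrM ler_pM2l //.
rewrite exchange_big /=.
have -> : (K1 * K2 * (4 * (4 * K1 * K2 * X)))%N = (2 * K1 * (2 * K2 * (4 * K1 * K2 * X)))%N by lia.
have -> : (2 * K1 * (2 * K2 * (4 * K1 * K2 * X)))%:R =
   \sum_(i < 2 * K1) \sum_(j < 2 * K2) (4 * K1 * K2 * X)%:R :> int.
  by rewrite !sumr_const !card_ord -!mulrnA; congr (_%:R); ring.
apply: ler_sum => i _; rewrite exchange_big /=; apply: ler_sum => j _.
apply: le_trans (sum_gridN i j pl _ _) _.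
- exact: qdisc_sqr_le1.
- by move=> d; apply: qdisc_Fp_corr => //; apply: leq_ltn_trans nz zl.
rewrite -!natrX -!natrM -natrD -natrM ler_nat.
have iK := ltn_ord i; have jK := ltn_ord j.
have ij : (i * j <= 4 * K1 * K2)%N.
  by rewrite (_ : 4 * K1 * K2 = (2 * K1) * (2 * K2))%N; [apply: leq_mul; exact: ltnW | lia].
apply: leq_mul => //; apply: leq_add.
  apply: leq_mul.
    by rewrite (_ : 64 = 4 ^ 3)%N // -expnMn leq_exp2r.
  apply: leq_mul; rewrite leq_add2r.
    by apply: leq_trans (leq_div2r _ (ltnW iK)) _; apply: leq_div2l => //; exact: ltnW.
  by apply: leq_trans (leq_div2r _ (ltnW jK)) _; apply: leq_div2l => //; exact: ltnW.
apply: leq_mul => //; apply: leq_mul => //.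
by rewrite (_ : 16 = 4 ^ 2)%N // -expnMn leq_exp2r.
Qed.

Definition offdiag_bound (n z H1 H2 : nat) : nat :=
  let K1 := (H1 %/ z + 1)%N in let K2 := (H2 %/ z + 1)%N in
  (minn (4 * z) H1 * minn (4 * z) H2 * (80 * (4 * (4 * K1 * K2 *
    (64 * z ^ 3 * ((2 * K1 %/ z + 1) * (2 * K2 %/ z + 1))
      + disc_corr_const n * (16 * z ^ 2) * (4 * K1 * K2))))))%N.

(** The square is expanded over pairs of primes. Equal primes get the trivial bound, distinct ones
    [bilinear_split]; after symmetrization each l carries only the sum of Q(l,r) over r <> l. The
    offset [c] depends on p because it is an integer vector reduced modulo p. *)
Lemma sieve_energy (n z H1 H2 : nat) (P : seq nat) (e : nat -> int)
    (c : forall p, 'F_p * 'F_p) :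
  odd n -> (1 < n)%N -> (n <= z)%N -> uniq P -> all (in_window z) P ->
  (forall p, e p ^+ 2 <= 1) ->
  \sum_(i : 'I_H1 * 'I_H2) \sum_(j : 'I_H1 * 'I_H2)
     (\sum_(p <- P) e p * qdisc n (c p + grid 1 i + grid 1 j)) ^+ 2 <=
  (size P * ((H1 * H2) ^ 2 + offdiag_bound n z H1 H2))%:R.
Proof.
move=> on n1 nz uP HP e1.
pose E l r := \sum_(i : 'I_H1 * 'I_H2) \sum_(j : 'I_H1 * 'I_H2)
  (e l * qdisc n (c l + grid 1 i + grid 1 j)) * (e r * qdisc n (c r + grid 1 i + grid 1 j)).
pose Q l r := fiberQ (@grid 'F_l 1 H1 H2) (@grid 'F_r 1 H1 H2) (qdisc n).
pose D l r : int := if r == l then ((H1 * H2) ^ 2)%:R else Q l r.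
have -> : \sum_(i : 'I_H1 * 'I_H2) \sum_(j : 'I_H1 * 'I_H2)
     (\sum_(p <- P) e p * qdisc n (c p + grid 1 i + grid 1 j)) ^+ 2 =
  \sum_(l <- P) \sum_(r <- P) E l r.
  under eq_bigr => i _ do under eq_bigr => j _ do rewrite expr2 big_distrlr /=.
  under eq_bigr => i _ do rewrite exchange_big /=.
  rewrite exchange_big /=; apply: eq_bigr => l _.
  under eq_bigr => i _ do rewrite exchange_big /=.
  by rewrite exchange_big.
have ED l r : E l r *+ 2 <= D l r + D r l.
  rewrite /D eq_sym; case: (eqVneq l r) => [<-|_].
    rewrite -mulr2n lerMn2r /= -mulnn natrM.
    have -> : (H1 * H2)%:R * (H1 * H2)%:R =
        \sum_(i : 'I_H1 * 'I_H2) \sum_(j : 'I_H1 * 'I_H2) 1 :> int.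
      by rewrite -natrM !sumr_const !card_prod !card_ord -mulrnA.
    apply: ler_sum => i _; apply: ler_sum => j _; rewrite -expr2 exprMn.
    by apply: mulr_ile1; rewrite ?sqr_ge0 ?e1 ?qdisc_sqr_le1.
  apply: le_trans (bilinear_split (@grid 'F_l 1 H1 H2) (@grid 'F_r 1 H1 H2)
     (fun x => e l * qdisc n x) (fun x => e r * qdisc n x) (c l) (c r)) _.
  by apply: lerD; apply: fiberQ_scale.
apply: (@le_trans _ _ (\sum_(l <- P) \sum_(r <- P) D l r)).
  suff : (\sum_(l <- P) \sum_(r <- P) E l r) *+ 2 <= (\sum_(l <- P) \sum_(r <- P) D l r) *+ 2.
    by rewrite lerMn2r.
  rewrite -!sumrMnl.
  apply: (@le_trans _ _ (\sum_(l <- P) \sum_(r <- P) (D l r + D r l))).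
    by apply: ler_sum => l _; rewrite -sumrMnl; apply: ler_sum => r _; exact: ED.
  under eq_bigr => l _ do rewrite big_split /=.
  rewrite big_split /= [X in _ + X <= _]exchange_big /= -big_split /=.
  by rewrite le_eqVlt; apply/orP; left; apply/eqP; apply: eq_bigr => l _; rewrite mulr2n.
rewrite natrM mulr_natl -[X in _ *+ X]count_predT -iter_addr_0 -big_const_seq.
rewrite big_seq [leRHS]big_seq; apply: ler_sum => l lP.
rewrite (bigD1_seq l) //= natrD; apply: lerD; first by rewrite /D eqxx.
rewrite (eq_bigr (Q l)); last by move=> r /negPf; rewrite /D => ->.
exact: (sum_fiberQ_le on n1 nz uP HP lP).
Qed.

(** Multiplying the quotients by z removes the divisions: z K1 <= 2A + z, z K2 <= 2B + z, and
    likewise for the inner quotients. What remains compares polynomials. *)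
Lemma sieve_arith (A B z K K1 K2 : nat) : (0 < z)%N -> (0 < A)%N -> (0 < B)%N ->
  K1 = (2 * A %/ z + 1)%N -> K2 = (2 * B %/ z + 1)%N ->
  (z ^ 3 * ((2 * K1 %/ z + 1) * (2 * K2 %/ z + 1)) + K * (z ^ 2 * (K1 * K2)) <=
  (24 + 4 * K) * (A * B + z ^ 3 + z * (A + B)))%N.
Proof.
move=> z0 A0 B0 eK1 eK2.
have a1 : (z * (2 * K1 %/ z) <= 2 * K1)%N by rewrite mulnC leq_divM.
have a2 : (z * (2 * K2 %/ z) <= 2 * K2)%N by rewrite mulnC leq_divM.
have k1 : (z * K1 <= 2 * A + z)%N by rewrite eK1 mulnDr muln1 leq_add2r mulnC leq_divM.
have k2 : (z * K2 <= 2 * B + z)%N by rewrite eK2 mulnDr muln1 leq_add2r mulnC leq_divM.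
have j2 : (K2 <= 3 * B)%N.
  by rewrite eK2; apply: (@leq_trans (2 * B + 1)); [rewrite leq_add2r leq_div | lia].
move: (2 * K1 %/ z)%N (2 * K2 %/ z)%N a1 a2 => a b a1 a2 {eK1 eK2}.
have z2 : (z * z <= z * (z * z))%N by rewrite leq_pmull.
have e3 : (z ^ 3 = z * (z * z))%N by rewrite !expnS expn0 muln1.
have T1 : (z ^ 3 * ((a + 1) * (b + 1)) <= z * ((2 * K1 + z) * (2 * K2 + z)))%N.
  have -> : (z ^ 3 * ((a + 1) * (b + 1)) = z * ((z * a + z) * (z * b + z)))%N by rewrite e3; ring.
  by rewrite leq_mul2l; apply/orP; right; apply: leq_mul; rewrite leq_add2r.
have T2 : (z ^ 2 * (K1 * K2) <= (2 * A + z) * (2 * B + z))%N.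
  have -> : (z ^ 2 * (K1 * K2) = (z * K1) * (z * K2))%N by ring.
  exact: leq_mul.
have T3 : (z * K1 * K2 <= (2 * A + z) * (3 * B))%N by exact: leq_mul.
have T4 : (z * (z * K1) <= z * (2 * A + z))%N by rewrite leq_mul2l k1 orbT.
have T5 : (z * (z * K2) <= z * (2 * B + z))%N by rewrite leq_mul2l k2 orbT.
have T6 : (z * z * z + z * z <= 2 * z ^ 3)%N by rewrite e3; lia.
apply: (@leq_trans (24 * (A * B + z ^ 3 + z * (A + B)) + K * (4 * (A * B + z ^ 3 + z * (A + B))))); last first.
  by rewrite mulnDl (mulnC 4 K) mulnA.
apply: leq_add; last rewrite leq_mul2l; last (apply/orP; right).
  by apply: leq_trans T1 _; rewrite e3; nia.
by apply: leq_trans T2 _; rewrite e3; nia.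
Qed.

(** The number of nonempty classes times the length bound of each gives back the side of the box up
    to a constant. *)
Lemma minn_divn_le (z H : nat) : (0 < z)%N -> (minn (4 * z) H * (H %/ z + 1) <= 5 * H)%N.
Proof.
move=> z0; have h : (H %/ z * z <= H)%N by exact: leq_divM.
have m1 : (minn (4 * z) H <= 4 * z)%N by exact: geq_minl.
have m2 : (minn (4 * z) H <= H)%N by exact: geq_minr.
rewrite mulnDr muln1; apply: (@leq_trans (4 * z * (H %/ z) + H)); last by lia.
by apply: leq_add => //; rewrite leq_mul2r m1 orbT.
Qed.

Lemma offdiag_bound_le (n : nat) : exists M : nat, forall z A B : nat,
  (0 < z)%N -> (0 < A)%N -> (0 < B)%N ->
  (offdiag_bound n z (2 * A) (2 * B) <= M * (A * B * (A * B + z ^ 3 + z * (A + B))))%N.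
Proof.
(* Each 10 is the 5 of [minn_divn_le] applied to a doubled side; 64 = 16 * 4 is common to both
   summands; the last factor comes from [sieve_arith]. *)
exists (80 * (4 * 4) * (10 * 10) * (64 * (24 + 4 * disc_corr_const n)))%N => z A B z0 A0 B0.
rewrite /offdiag_bound.
have a1 := minn_divn_le (2 * A) z0; have a2 := minn_divn_le (2 * B) z0.
have a3 := sieve_arith (disc_corr_const n) z0 A0 B0 erefl erefl.
move: a1 a2 a3.
move: (minn _ (2 * A)) (minn _ (2 * B)) (2 * A %/ z + 1)%N (2 * B %/ z + 1)%N => R1 R2 K1 K2.
move: (2 * K1 %/ z + 1)%N (2 * K2 %/ z + 1)%N (disc_corr_const n) => u v K a1 a2 a3.
move: (A * B + z ^ 3 + z * (A + B))%N a3 => Y a3.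
have -> : (R1 * R2 * (80 * (4 * (4 * K1 * K2 *
   (64 * z ^ 3 * (u * v) + K * (16 * z ^ 2) * (4 * K1 * K2))))) =
   80 * (4 * 4) * ((R1 * K1) * (R2 * K2)) * (64 * (z ^ 3 * (u * v) + K * (z ^ 2 * (K1 * K2)))))%N.
  by ring.
have -> : (80 * (4 * 4) * (10 * 10) * (64 * (24 + 4 * K)) * (A * B * Y) =
   80 * (4 * 4) * ((10 * A) * (10 * B)) * (64 * ((24 + 4 * K) * Y)))%N by ring.
apply: leq_mul; last by rewrite leq_mul2l a3 orbT.
rewrite leq_mul2l; apply/orP; right; apply: leq_mul; lia.
Qed.

Definition discz (n a b : nat) : int := (n.-1 ^ n.-1 * a ^ n + n ^ n * b ^ n.-1)%:Z.

Lemma disc_natr (F : finFieldType) (n a b : nat) :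
  disc n (a%:R, b%:R) = (discz n a b)%:~R :> F.
Proof. by rewrite /disc /discz /= -pmulrn natrD !natrM !natrX. Qed.

(* If p divides s then the product vanishes, but then p divides the discriminant too. *)
Lemma qdisc_twisted (p n a b : nat) (s r : int) : odd #|'F_p| -> discz n a b = s * r ^+ 2 ->
  1 <= qchar (s%:~R : 'F_p) * qdisc n ((a%:R, b%:R) : 'F_p * 'F_p)
       + (disc n ((a%:R, b%:R) : 'F_p * 'F_p) == 0)%:R.
Proof.
move=> oF E; case: eqVneq => D; first by rewrite /qdisc D qchar0 mulr0.
rewrite addr0 /qdisc; move: D; rewrite disc_natr E rmorphM rmorphXn /= => D.
have [s0 r0] : (s%:~R : 'F_p) != 0 /\ (r%:~R : 'F_p) != 0.
  by move: D; rewrite mulf_eq0 negb_or expf_eq0 /= => /andP[].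
by rewrite qcharM // qchar_sqr // mulr1 -expr2 qchar_sqr1.
Qed.

(** The bound is linear in W on purpose: W will count the primes dividing a discriminant, and only
    its mean over the box is estimated. *)
Lemma sqr_le_twice (q G W : int) : 0 <= W -> W <= q -> q <= G + W ->
  q ^+ 2 <= 2 * G ^+ 2 + 2 * q * W.
Proof.
move=> W0 Wq qGW.
have h : (q - W) ^+ 2 <= G ^+ 2 by rewrite ler_sqr ?nnegrE; lra.
have h2 : W * W <= q * W by apply: ler_wpM2r.
have := sqr_ge0 (q - 2 * W); nra.
Qed.

Lemma sieve_bound (n : nat) : odd n -> (1 < n)%N -> exists K : nat,
  forall (z A B c d : nat) (s : int) (P : seq nat) (S : seq (nat * nat)),
  (n <= z)%N -> (0 < A)%N -> (0 < B)%N -> uniq P -> all (in_window z) P -> uniq S ->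
  (forall e, e \in S -> [/\ (e.1 < A)%N, (e.2 < B)%N &
     exists r : int, discz n (c + e.1) (d + e.2) = s * r ^+ 2]) ->
  (size P * size S <= K * (A * B + z ^ 3 + z * (A + B)))%N.
Proof.
move=> on n1; have [M HM] := offdiag_bound_le n.
(* The three parts pay for equal primes, for distinct primes, and for primes dividing the
   discriminant. *)
exists (32 + 2 * M + 8 * n)%N => z A B c d s P S nz A0 B0 uP HP uS HS.
have z0 : (0 < z)%N by lia.
have {}HM := HM z A B z0 A0 B0.
pose e (p : nat) : int := qchar (s%:~R : 'F_p).
(* Subtracting A and B moves the box to [A, 2A) x [B, 2B), where [window_sum2] applies. *)
pose c0 p : 'F_p * 'F_p := (c%:R - A%:R, d%:R - B%:R).
pose g x y := \sum_(p <- P) e p * qdisc n (c0 p + (x%:R, y%:R)).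
pose w i j : int := \sum_(p <- P) (disc n (((c + i)%:R, (d + j)%:R) : 'F_p * 'F_p) == 0)%:R.
pose q : int := (size P)%:R.
pose Y := (A * B + z ^ 3 + z * (A + B))%N.
have w0 i j : 0 <= w i j by apply: sumr_ge0.
have wq i j : w i j <= q.
  rewrite /q -sum1_size natr_sum; apply: ler_sum => p _; by case: eqP.
have q0 : 0 <= q by [].
have oddp p : p \in P -> odd #|'F_p|.
  move=> /(allP HP) /andP[pp /andP[zp _]]; rewrite card_Fp //.
  by case: (even_prime pp) => // p2; move: zp; rewrite p2; lia.
have L1 x : x \in S -> q ^+ 2 <= 2 * g (A + x.1)%N (B + x.2)%N ^+ 2 + 2 * q * w x.1 x.2.
  move=> xS; have [_ _ [r Er]] := HS _ xS.
  have : q <= g (A + x.1)%N (B + x.2)%N + w x.1 x.2.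
    rewrite /q /g /w -sum1_size natr_sum -big_split big_seq [leRHS]big_seq.
    apply: ler_sum => p pP; apply: le_trans (qdisc_twisted (oddp _ pP) Er) _.
    rewrite lerD2r /e le_eqVlt; apply/orP; left; apply/eqP; congr (_ * qdisc n _).
    by congr pair; rewrite /= !natrD; ring.
  exact: sqr_le_twice.
pose F := \sum_(i < A) \sum_(j < B) g (A + i)%N (B + j)%N ^+ 2.
pose W := \sum_(i < A) \sum_(j < B) w i j.
have L2 : q ^+ 2 * (size S)%:R <= 2 * F + 2 * q * W.
  have -> : 2 * F + 2 * q * W = \sum_(i < A) \sum_(j < B)
      (2 * g (A + i)%N (B + j)%N ^+ 2 + 2 * q * w i j).
    rewrite /F /W !mulr_sumr -big_split; apply: eq_bigr => i _.
    by rewrite !mulr_sumr -big_split.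
  apply: le_trans (ler_sum_box (f := fun i j => 2 * g (A + i)%N (B + j)%N ^+ 2 + 2 * q * w i j) uS _ _).
  - rewrite -sum1_size natr_sum mulr_sumr big_seq [leRHS]big_seq.
    by apply: ler_sum => x xS; rewrite mulr1; exact: L1.
  - by move=> x /HS [-> ->].
  - move=> i j; apply: addr_ge0; apply: mulr_ge0 => //; first exact: sqr_ge0.
    by apply: mulr_ge0.
have L3 : (A * B)%:R * F <= q * ((2 * A * (2 * B)) ^ 2 + M * (A * B * Y))%:R.
  rewrite natrM; apply: le_trans (window_sum2 A B (f := fun i j => g i j ^+ 2) _) _.
    by move=> i j; exact: sqr_ge0.
  have := sieve_energy (2 * A) (2 * B) c0 on n1 nz uP HP (fun p => qchar_sqr_le1 (s%:~R : 'F_p)).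
  move=> H; apply: le_trans (le_trans _ H) _.
    rewrite le_eqVlt; apply/orP; left; apply/eqP; apply: eq_bigr => i _; apply: eq_bigr => j _.
    congr (_ ^+ 2); apply: eq_bigr => p _; congr (_ * qdisc n _).
    by rewrite /grid; congr pair; rewrite /= natrD !mul1r addrA.
  by rewrite natrM /q; apply: ler_wpM2l => //; rewrite ler_nat leq_add2l.
(* For each prime p and each b, the discriminant vanishes for at most n classes of a modulo p. *)
have L4 : W <= q * (B * (n * (A %/ z + 1)))%:R.
  have -> : W = \sum_(p <- P) \sum_(j < B) \sum_(i < A)
      (disc n (((c + i)%:R, (d + j)%:R) : 'F_p * 'F_p) == 0)%:R.
    rewrite /W /w; under eq_bigr => i _ do rewrite exchange_big /=.
    by rewrite exchange_big /=; apply: eq_bigr => p _; rewrite exchange_big.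
  rewrite /q -sum1_size natr_sum mulr_suml big_seq [leRHS]big_seq.
  apply: ler_sum => p /(allP HP) /andP[pp /andP[zp _]]; rewrite mul1r.
  apply: (@le_trans _ _ (\sum_(j < B) (n * (A %/ z + 1))%:R)).
    apply: ler_sum => j _; apply: le_trans (count_disc0 _ _ _ pp _ _) _; first by lia.
      by apply: Fp_natr_neq0 => //; lia.
    rewrite ler_nat leq_mul2l leq_add2r; apply/orP; right.
    by apply: leq_div2l => //; exact: ltnW.
  by rewrite sumr_const card_ord -mulrnA mulnC.
have q4 : (size P <= 4 * z)%N.
  rewrite -(size_iota 1 (4 * z)); apply: uniq_leq_size => // p.
  move=> /(allP HP) /andP[pp /andP[zp p4]].
  by rewrite mem_iota; lia.
have L5 : (2 * size P * (B * (n * (A %/ z + 1))) <= 8 * n * Y)%N.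
  have h : (z * (A %/ z) <= A)%N by rewrite mulnC leq_divM.
  apply: (@leq_trans (8 * n * (B * (z * (A %/ z) + z)))).
    have -> : (8 * n * (B * (z * (A %/ z) + z)) = 2 * (4 * z) * (B * (n * (A %/ z + 1))))%N by ring.
    by rewrite leq_mul2r leq_mul2l q4 !orbT.
  rewrite leq_mul2l; apply/orP; right; rewrite /Y.
  by apply: (@leq_trans (B * (A + z))); [rewrite leq_mul2l leq_add2r h orbT | nia].
have [/eqP q00|qpos] := eqVneq (size P) 0%N; first by rewrite (eqP q00).
rewrite -(@leq_pmul2l (A * B * size P)); last by rewrite !muln_gt0 A0 B0 lt0n.
rewrite -(ler_nat int).
have ABz : 0 <= (A * B)%:R :> int by [].
have := ler_wpM2l ABz L2.
have -> : (A * B)%:R * (q ^+ 2 * (size S)%:R) = (A * B * size P * (size P * size S))%:R.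
  by rewrite !natrM /q; ring.
move=> L6; apply: le_trans L6 _.
rewrite mulrDr mulrCA (mulrCA (A * B)%:R).
apply: (@le_trans _ _ (2 * (q * ((2 * A * (2 * B)) ^ 2 + M * (A * B * Y))%:R)
   + 2 * q * ((A * B)%:R * (q * (B * (n * (A %/ z + 1)))%:R)))).
  apply: lerD; first by rewrite ler_pM2l.
  by apply: ler_wpM2l; [rewrite mulr_ge0 | apply: ler_wpM2l].
set L := (B * (n * (A %/ z + 1)))%N in L5 *.
have -> : 2 * (q * ((2 * A * (2 * B)) ^ 2 + M * (A * B * Y))%:R) + 2 * q * ((A * B)%:R * (q * L%:R))
    = (A * B * size P * (32 * (A * B) + 2 * M * Y + 2 * size P * L))%:R.
  by rewrite /q -mulnn !(natrD, natrM); ring.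
rewrite ler_nat leq_mul2l; apply/orP; right.
rewrite -/Y; have -> : ((32 + 2 * M + 8 * n) * Y = 32 * Y + 2 * M * Y + 8 * n * Y)%N by ring.
apply: leq_add => //.
by rewrite leq_add2r leq_mul2l /= /Y -addnA leq_addr.
Qed.

(** * Chebyshev's lower bound *)

Local Open Scope nat_scope.
Lemma prod_primes_dvd (s : seq nat) (N : nat) : uniq s ->
  all (fun p => prime p && (p %| N)) s -> \prod_(p <- s) p %| N.
Proof.
elim: s => [|p s IH] /=; first by rewrite big_nil dvd1n.
move=> /andP[ps us] /andP[/andP[pp pN] hs]; rewrite big_cons Gauss_dvd ?pN ?IH //.
elim: s ps hs {IH us} => [|r s IH]; first by rewrite big_nil coprimen1.
rewrite inE negb_or /= => /andP[pr ps] /andP[/andP[rr _] hs].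
by rewrite big_cons coprimeMr IH // andbT prime_coprime // dvdn_prime2.
Qed.

Definition primes_upto (m : nat) : seq nat := [seq p <- iota 0 m.+1 | prime p].

Lemma mem_primes_upto m p : (p \in primes_upto m) = prime p && (p <= m).
Proof. by rewrite mem_filter mem_iota. Qed.

Lemma uniq_primes_upto m : uniq (primes_upto m).
Proof. exact/filter_uniq/iota_uniq. Qed.

Lemma central_bin_le (N : nat) : 'C(2 * N, N) <= 4 ^ N.
Proof.
rewrite -[4]/((1 + 1) ^ 2) -expnM expnDn.
have NN : N < (2 * N).+1 by lia.
rewrite (bigD1 (Ordinal NN)) //= !exp1n !muln1; exact: leq_addr.
Qed.

(** Induction with (M + 1) 'C(2M + 2, M + 1) = 2 (2M + 1) 'C(2M, M). *)
Lemma central_bin_ge (N : nat) : 0 < N -> 4 ^ N <= 2 * N * 'C(2 * N, N).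
Proof.
elim: N => // -[_ _|N IH _]; first by rewrite (_ : 2 * 1 = 2) // binn.
set M := N.+1 in IH *.
have E1 : M.+1 * 'C(2 * M.+1, M.+1) = 2 * ((2 * M).+1 * 'C(2 * M, M)).
  have -> : 2 * M.+1 = (2 * M).+2 by lia.
  rewrite binS.
  have -> : 'C((2 * M).+1, M) = 'C((2 * M).+1, M.+1).
    by rewrite -bin_sub; [congr 'C(_, _); lia | lia].
  by rewrite addnn -mul2n mulnCA -mul_bin_diag.
rewrite -mulnA E1 expnS.
have := IH isT; lia.
Qed.

Lemma prime_dvd_fact (p m : nat) : prime p -> p %| m`! -> p <= m.
Proof.
move=> pp; elim: m => [|m IH]; first by rewrite fact0 Euclid_dvd1.
rewrite factS Euclid_dvdM // => /orP[/dvdn_leq -> //|/IH]; lia.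
Qed.

(* The primes in (2^k, 2^(k+1)] divide the central binomial coefficient 'C(2^(k+1), 2^k). *)
Lemma primorial_pow2 (k : nat) : \prod_(p <- primes_upto (2 ^ k)) p <= 4 ^ (2 ^ k).
Proof.
elim: k => [|k IH].
  by rewrite /primes_upto /= big_nil.
have E : perm_eq (primes_upto (2 ^ k.+1))
   (primes_upto (2 ^ k) ++ [seq p <- primes_upto (2 ^ k.+1) | 2 ^ k < p]).
  apply: uniq_perm; rewrite ?uniq_primes_upto //.
    rewrite cat_uniq uniq_primes_upto filter_uniq ?uniq_primes_upto // andbT /=.
    apply/hasPn => p; rewrite mem_filter => /andP[kp _].
    by rewrite mem_primes_upto leqNgt kp andbF.
  move=> p; rewrite mem_cat !mem_primes_upto mem_filter mem_primes_upto expnS.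
  by case: (prime p); rewrite ?andbF //= ?andbT; lia.
rewrite (perm_big _ E) big_cat /= [2 ^ k.+1 in leqRHS]expnS mul2n -addnn expnD.
apply: leq_mul => //.
apply: leq_trans (central_bin_le (2 ^ k)); apply: dvdn_leq; first by rewrite bin_gt0; lia.
apply: prod_primes_dvd; first exact/filter_uniq/uniq_primes_upto.
apply/allP => p; rewrite mem_filter mem_primes_upto expnS => /andP[kp /andP[pp p2]].
rewrite pp /=.
have := bin_fact (_ : 2 ^ k <= 2 * 2 ^ k); rewrite leq_pmull // => /(_ isT).
have -> : 2 * 2 ^ k - 2 ^ k = 2 ^ k by lia.
move=> F; have : p %| (2 * 2 ^ k)`! by rewrite dvdn_fact // prime_gt0.
rewrite -F !Euclid_dvdM // => /orP[//|].
by rewrite orbb => /(prime_dvd_fact pp); rewrite leqNgt kp.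
Qed.

(** In Legendre's formula each power p^i contributes at most 1 to the exponent, and nothing once p^i
    > m. *)
Lemma logn_bin_le (p m k : nat) : prime p -> k <= m -> logn p 'C(m, k) <= trunc_log p m.
Proof.
move=> pp km; have p1 := prime_gt1 pp.
have C0 : 0 < 'C(m, k) by rewrite bin_gt0.
have := congr1 (logn p) (bin_fact km).
rewrite !lognM ?muln_gt0 ?fact_gt0 // !logn_fact //.
have ext j : j <= m -> \sum_(1 <= i < j.+1) j %/ p ^ i = \sum_(1 <= i < m.+1) j %/ p ^ i.
  move=> jm; rewrite [RHS](@big_cat_nat _ _ _ j.+1) //= [X in _ + X]big_nat [X in _ + X]big1 ?addn0 // => i /andP[ji _].
  by rewrite divn_small //; apply: leq_trans ji _; apply: ltnW; apply: ltn_expl.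
rewrite !ext ?leq_subr // => E.
have : \sum_(1 <= i < m.+1) m %/ p ^ i <=
  \sum_(1 <= i < m.+1) (k %/ p ^ i + (m - k) %/ p ^ i + (i <= trunc_log p m)).
  apply: leq_sum => i _; case: (leqP i (trunc_log p m)) => h.
    by rewrite -{1}(subnKC km) leq_divDl.
  rewrite divn_small //; apply: leq_trans (trunc_log_ltn m p1) _.
  by rewrite leq_exp2l.
rewrite !big_split /= -E addnC leq_add2l => /leq_trans; apply.
have -> : \sum_(1 <= i < m.+1) (i <= trunc_log p m) = count (fun i => i <= trunc_log p m) (iota 1 m).
  by rewrite -sumn_count sumnE big_map /index_iota subSS subn0.
rewrite -size_filter -[leqRHS](size_iota 1); apply: uniq_leq_size.
  exact/filter_uniq/iota_uniq.
by move=> i; rewrite mem_filter !mem_iota; lia.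
Qed.

Lemma prime_pow_bin_le (p m k : nat) : prime p -> 0 < m -> k <= m -> p ^ logn p 'C(m, k) <= m.
Proof.
move=> pp m0 km; apply: leq_trans (trunc_logP (prime_gt1 pp) m0).
by rewrite leq_exp2l ?prime_gt1 // logn_bin_le.
Qed.

Lemma prod_le_exp (s : seq nat) (f : nat -> nat) (m : nat) :
  (forall p, p \in s -> f p <= m) -> \prod_(p <- s) f p <= m ^ size s.
Proof.
elim: s => [|p s IH] H; first by rewrite big_nil.
rewrite big_cons /= expnS leq_mul ?H ?mem_head // IH // => r rs.
by rewrite H // inE rs orbT.
Qed.

Lemma prod_le_subset (s1 s2 : seq nat) : uniq s1 -> uniq s2 ->
  (forall p, p \in s2 -> 0 < p) -> {subset s1 <= s2} ->
  \prod_(p <- s1) p <= \prod_(p <- s2) p.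
Proof.
move=> u1 u2 s0 s12.
have pE : perm_eq s2 (s1 ++ [seq p <- s2 | p \notin s1]).
  apply: uniq_perm => //.
    rewrite cat_uniq u1 filter_uniq // andbT /=.
    by apply/hasPn => p; rewrite mem_filter => /andP[].
  move=> p; rewrite mem_cat mem_filter.
  by case: (boolP (p \in s1)) => //= /s12 ->.
rewrite (perm_big _ pE) big_cat /= leq_pmulr // big_seq prodn_cond_gt0 // => p.
by rewrite mem_filter => /andP[_ /s0].
Qed.

Definition window (z : nat) : seq nat := [seq p <- iota 0 (4 * z).+1 | in_window z p].

Lemma mem_window z p : (p \in window z) = in_window z p.
Proof. by rewrite mem_filter mem_iota /in_window; lia. Qed.

(* A prime power dividing the binomial coefficient is at most 4z = (2^(t+1))^2, and it is a
   first power if the prime exceeds 2^(t+1). *)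
Lemma window_bin (t z : nat) : z = 4 ^ t ->
  'C(2 * (2 * z), 2 * z) <= (4 * z) ^ (2 ^ t.+1) * (4 ^ z * (4 * z) ^ size (window z)).
Proof.
move=> zE; set m := 2 * (2 * z); have mE : m = 4 * z by rewrite /m; lia.
have z0 : 0 < z by rewrite zE expn_gt0.
set C := 'C(m, 2 * z); have km : 2 * z <= m by rewrite /m; lia.
have C0 : 0 < C by rewrite bin_gt0.
have m0 : 0 < m by rewrite mE; lia.
have -> : C = \prod_(p <- primes C) p ^ logn p C.
  by rewrite {1}(prod_prime_decomp C0) prime_decompE big_map.
have PC p : p \in primes C -> prime p /\ p <= m.
  rewrite mem_primes => /and3P[pp _ pC]; split=> //; apply: (prime_dvd_fact pp).
  by rewrite -(bin_fact km); apply: dvdn_mulr.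
rewrite (bigID (fun p => p <= 2 ^ t.+1)) /=; apply: leq_mul.
  rewrite -big_filter; apply: leq_trans (prod_le_exp (m := m) _) _.
    by move=> p; rewrite mem_filter => /andP[_ /PC[pp _]]; apply: prime_pow_bin_le.
  rewrite -mE leq_exp2l; last by rewrite mE; lia.
  rewrite -[leqRHS](size_iota 1); apply: uniq_leq_size; first exact/filter_uniq/primes_uniq.
  move=> p; rewrite mem_filter mem_iota => /andP[h /PC[/prime_gt0]]; lia.
rewrite (bigID (fun p => p <= z)) /=; apply: leq_mul.
  have z2 : z = 2 ^ (2 * t) by rewrite expnM.
  rewrite [in leqRHS]z2; apply: leq_trans (primorial_pow2 (2 * t)).
  rewrite -big_filter.
  set s := filter _ _.
  apply: (@leq_trans (\prod_(p <- s) p)).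
    rewrite big_seq [leqRHS]big_seq; apply: leq_prod => p.
    rewrite mem_filter -ltnNge => /andP[/andP[h _] /PC[pp pm]].
    rewrite -[leqRHS]expn1 leq_exp2l ?prime_gt1 //.
    apply: leq_trans (logn_bin_le pp km) _.
    rewrite -ltnS -(@ltn_exp2l p) ?prime_gt1 //.
    apply: leq_ltn_trans (trunc_logP (prime_gt1 pp) m0) _.
    apply: (@leq_trans ((2 ^ t.+1).+1 ^ 2)); last by rewrite leq_exp2r.
    have -> : m = (2 ^ t.+1) ^ 2 by rewrite mE zE -expnS -[4]/(2 ^ 2) -!expnM mulnC.
    by rewrite ltn_exp2r.
  apply: prod_le_subset; first exact/filter_uniq/primes_uniq.
  - exact: uniq_primes_upto.
  - by move=> p; rewrite mem_primes_upto => /andP[/prime_gt0].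
  move=> p; rewrite mem_filter mem_primes_upto -z2 => /andP[/andP[_ h] /PC[-> _]].
  exact: h.
rewrite -big_filter; apply: leq_trans (prod_le_exp (m := m) _) _.
  by move=> p; rewrite mem_filter => /andP[_ /PC[pp _]]; apply: prime_pow_bin_le.
rewrite -mE leq_exp2l; last by rewrite mE; lia.
apply: uniq_leq_size; first exact/filter_uniq/primes_uniq.
move=> p; rewrite mem_filter mem_window /in_window => /andP[/andP[_ h] /PC[-> pm]].
by rewrite ltnNge h -mE.
Qed.

Lemma pow2_ge (t : nat) : 6 <= t -> 8 * t.+1 <= 2 ^ t.
Proof.
move=> t6; rewrite -(subnK t6); elim: (t - 6) => [//|k IH].
by rewrite addSn expnS; lia.
Qed.

(** Comparing exponents of 4 in the two bounds for the central binomial coefficient gives z <= (t +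
    1)(2^(t+1) + q + 1). Since z = (2^t)^2, [pow2_ge] makes the part without q at most z / 2. *)
Lemma window_large (t : nat) : 6 <= t -> 4 ^ t <= 2 * t.+1 * size (window (4 ^ t)).
Proof.
move=> t6; set z := 4 ^ t; set q := size _.
have z0 : 0 < z by rewrite expn_gt0.
have m0 : 0 < 2 * z by lia.
have := leq_trans (central_bin_ge m0) (leq_mul (leqnn _) (window_bin (erefl z))).
rewrite -/z -/q (_ : 2 * (2 * z) = 4 * z); last by lia.
rewrite [4 ^ (2 * z)](_ : _ = 4 ^ z * 4 ^ z); last by rewrite -expnD; congr (_ ^ _); lia.
rewrite (_ : _ * (_ * _) = 4 ^ z * (4 * z) ^ (2 ^ t.+1 + q).+1); last first.
  rewrite [(4 * z) ^ _.+1]expnS [(4 * z) ^ (_ + q)]expnD.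
  by rewrite [RHS]mulnCA (mulnCA (4 ^ z) ((4 * z) ^ 2 ^ t.+1)).
rewrite leq_pmul2l ?expn_gt0 // (_ : 4 * z = 4 ^ t.+1); last by rewrite expnS.
rewrite -expnM leq_exp2l //.
have := pow2_ge t6.
have zE : z = 2 ^ t * 2 ^ t by rewrite /z -[4]/(2 * 2) expnMn.
have h : 0 < 2 ^ t by rewrite expn_gt0.
rewrite zE (expnS 2 t); move: (2 ^ t) h => u u0; nia.
Qed.

(** * The sieve at powers of four, and its transfer to the standard library *)

Local Open Scope ring_scope.
Lemma sieve_bound_pow4 (n : nat) : odd n -> (1 < n)%N -> exists K : nat,
  forall (t A B c d : nat) (s : int) (S : seq (nat * nat)),
  (6 <= t)%N -> (n <= 4 ^ t)%N -> (0 < A)%N -> (0 < B)%N -> uniq S ->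
  (forall e, e \in S -> [/\ (e.1 < A)%N, (e.2 < B)%N &
     exists r : int, discz n (c + e.1) (d + e.2) = s * r ^+ 2]) ->
  (4 ^ t * size S <= K * t.+1 * (A * B + (4 ^ t) ^ 3 + 4 ^ t * (A + B)))%N.
Proof.
move=> on n1; have [K HK] := sieve_bound on n1.
exists (2 * K)%N => t A B c d s S t6 nz A0 B0 uS HS.
set z := (4 ^ t)%N in nz *.
have allW : all (in_window z) (window z) by apply/allP => p; rewrite mem_window.
have uW : uniq (window z) by exact/filter_uniq/iota_uniq.
have := HK z A B c d s (window z) S nz A0 B0 uW allW uS HS.
have := window_large t6; rewrite -/z.
move: (A * B + _ + _)%N (size S) (size _) => Y N q h1 h2.
apply: (@leq_trans (2 * t.+1 * q * N)); first by rewrite leq_mul2r h1 orbT.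
have -> : (2 * t.+1 * q * N = 2 * t.+1 * (q * N))%N by ring.
have -> : (2 * K * t.+1 * Y = 2 * t.+1 * (K * Y))%N by ring.
by rewrite leq_mul2l h2 orbT.
Qed.

Lemma In_mem (T : eqType) (x : T) (s : seq T) : List.In x s <-> x \in s.
Proof.
elim: s => [|y s IH] //=; rewrite inE; split.
  by case=> [->|/IH ->]; rewrite ?eqxx ?orbT.
by case/orP=> [/eqP ->|/IH]; [left | right].
Qed.

Lemma NoDup_uniq (T : eqType) (s : seq T) : List.NoDup s -> uniq s.
Proof.
elim=> [|x {}s xs _ IH] //=; rewrite IH andbT.
by apply/negP => /In_mem.
Qed.

Lemma expn_pow (a b : nat) : (a ^ b)%N = Nat.pow a b.
Proof. by elim: b => // b IH; rewrite expnS IH. Qed.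

Lemma Delta_discz (n a b : nat) (s r : Z) : (1 < n)%N ->
  Defs.Delta n (Z.of_nat a) (Z.of_nat b) = Z.mul s (Z.pow r 2) ->
  discz n a b = int_of_Z s * int_of_Z r ^+ 2.
Proof.
move=> n1; rewrite /Defs.Delta /discz => E.
have e1 : Z.sub (Z.of_nat n) 1 = Z.of_nat n.-1 by lia.
rewrite e1 -!Nat2Z.inj_pow -!Nat2Z.inj_mul -Nat2Z.inj_add in E.
apply: (can_inj Z_of_intK); rewrite /= !expn_pow.
have -> : Z_of_int (int_of_Z s * int_of_Z r ^+ 2) = Z.mul s (Z.pow r 2).
  rewrite expr2; lia.
exact: E.
Qed.

(** [sieve_bound_pow4] in terms of standard library types, the form in which the real estimates
    below use it. *)
Lemma Delta_count (n : nat) : Nat.odd n = true -> lt 1 n -> exists K : nat,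
  forall (t A B c d : nat) (s : Z) (S : list (nat * nat)),
  le 6 t -> le n (Nat.pow 4 t) -> lt 0 A -> lt 0 B -> List.NoDup S ->
  (forall e, List.In e S -> lt (fst e) A /\ lt (snd e) B /\
     exists r : Z, Defs.Delta n (Z.of_nat (Nat.add c (fst e))) (Z.of_nat (Nat.add d (snd e)))
       = Z.mul s (Z.pow r 2)) ->
  le (Nat.mul (Nat.pow 4 t) (length S))
    (Nat.mul (Nat.mul K (Datatypes.S t))
       (Nat.add (Nat.add (Nat.mul A B) (Nat.pow (Nat.pow 4 t) 3)) (Nat.mul (Nat.pow 4 t) (Nat.add A B)))).
Proof.
move=> on /ssrnat.ltP n1; have {}on : odd n.
  rewrite (_ : odd n = Nat.odd n) //.
  by elim: (n) => // m IH; rewrite Nat.odd_succ -Nat.negb_odd /= IH.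
have [K HK] := sieve_bound_pow4 on n1.
exists K => t A B c d s S t6 nt A0 B0 uS HS.
have := HK t A B c d (int_of_Z s) S.
rewrite !expn_pow => H; apply/ssrnat.leP; apply: H; try exact/ssrnat.leP.
  exact: NoDup_uniq.
move=> e /In_mem /HS [/ssrnat.ltP eA [/ssrnat.ltP eB [r Er]]]; split=> //.
by exists (int_of_Z r); exact: Delta_discz.
Qed.

End Sieve.

Import Sieve.

(** * The count over a real box *)

Lemma list_prod_NoDup (X Y : Type) (l : list X) (m : list Y) :
  NoDup l -> NoDup m -> NoDup (list_prod l m).
Proof.
  intros Hl Hm. induction Hl as [|x l Hx Hl IH]; simpl; [constructor|].
  apply NoDup_app; auto.
  - apply FinFun.Injective_map_NoDup; auto. intros y y' E. now injection E.
  - intros [x' y] H1 H2. apply in_map_iff in H1. destruct H1 as [y' [E _]].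
    injection E as -> ->. apply in_prod_iff in H2. tauto.
Qed.

Lemma zrange_NoDup (X : R) : NoDup (zrange X).
Proof.
  apply FinFun.Injective_map_NoDup; [exact Nat2Z.inj | apply seq_NoDup].
Qed.

Lemma decb_true (P : Prop) : decb P = true -> P.
Proof. unfold decb. destruct (excluded_middle_informative P); congruence. Qed.

(** Solutions are recorded as offsets from the integer corner (c, d), whose size is independent of C
    and D; this is the source of the uniformity in C and D. *)
Lemma shifted_pairs (n : nat) (A B C D : R) (s : Z) (c d : nat) :
  INR c <= C -> INR d <= D ->
  exists S : list (nat * nat), NoDup S /\ length S = T_n n A B C D s /\
  forall e, In e S -> INR (c + fst e) <= C + A /\ INR (d + snd e) <= D + B /\
    exists r : Z, Defs.Delta n (Z.of_nat (c + fst e)) (Z.of_nat (d + snd e)) = (s * r ^ 2)%Z.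
Proof.
  intros Hc Hd.
  set (L := filter (fun p => decb (T_pred n A B C D s p))
              (list_prod (zrange (C + A)) (zrange (D + B)))).
  assert (HL : forall a b, In (a, b) L ->
    (Z.of_nat c <= a)%Z /\ (Z.of_nat d <= b)%Z /\ T_pred n A B C D s (a, b)).
  { intros a b H. apply filter_In in H. destruct H as [_ H].
    apply decb_true in H. split; [|split]; [| |exact H];
    destruct H as [[H1 _] [[H2 _] _]]; simpl in H1, H2;
    apply le_IZR; rewrite <- INR_IZR_INZ; lra. }
  exists (map (fun p => (Z.to_nat (fst p - Z.of_nat c), Z.to_nat (snd p - Z.of_nat d))) L).
  split; [|split].
  - apply NoDup_map_NoDup_ForallPairs.
    + intros [a b] [a' b'] H H' E. apply HL in H. apply HL in H'.
      simpl in E. injection E as E1 E2. f_equal; lia.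
    + apply NoDup_filter, list_prod_NoDup; apply zrange_NoDup.
  - apply length_map.
  - intros e He. apply in_map_iff in He. destruct He as [[a b] [<- Hab]].
    destruct (HL _ _ Hab) as [Ha [Hb [[_ H1] [[_ H2] H3]]]]. simpl in *.
    replace (Z.of_nat (c + Z.to_nat (a - Z.of_nat c))) with a by lia.
    replace (Z.of_nat (d + Z.to_nat (b - Z.of_nat d))) with b by lia.
    rewrite !INR_IZR_INZ.
    replace (Z.of_nat (c + Z.to_nat (a - Z.of_nat c))) with a by lia.
    replace (Z.of_nat (d + Z.to_nat (b - Z.of_nat d))) with b by lia.
    auto.
Qed.

(** * Floors, powers of four and logarithms *)

Lemma INR_floor (x : R) : 0 <= x -> exists m : nat, INR m <= x < INR m + 1.
Proof.
  intros Hx. destruct (archimed x) as [H1 H2].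
  assert (0 < up x)%Z by (apply lt_IZR; lra).
  exists (Z.to_nat (up x - 1)). rewrite INR_IZR_INZ, Z2Nat.id by lia.
  rewrite minus_IZR. lra.
Qed.

Lemma pow4_between (X : R) : 1 <= X -> exists t : nat, X <= 4 ^ t <= 4 * X.
Proof.
  intros HX.
  assert (K : exists k, X <= 4 ^ k).
  { destruct (Pow_x_infinity 4 ltac:(rewrite Rabs_pos_eq; lra) X) as [k Hk].
    exists k. specialize (Hk k (le_n k)). rewrite Rabs_pos_eq in Hk; [lra|].
    apply pow_le; lra. }
  destruct K as [k Hk]. induction k as [|k IH]; [exists 0%nat; simpl in *; lra|].
  destruct (Rle_dec X (4 ^ k)) as [H|H]; [auto|].
  exists (S k). simpl in *. lra.
Qed.

Lemma logm_ge1 (x : R) : 1 <= logm x.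
Proof. apply Rmax_r. Qed.

Lemma ln_nonneg (x : R) : 1 <= x -> 0 <= ln x.
Proof.
  intros [H|<-]; rewrite <- ln_1; [left; apply ln_increasing; lra | right; reflexivity].
Qed.

Lemma pow4_exponent_le (X : R) (t : nat) : 1 <= X -> 4 ^ t <= 4 * X -> INR t <= 1 + ln X.
Proof.
  intros HX H.
  assert (L4 : 1 <= ln 4).
  { rewrite <- (ln_exp 1). left. apply ln_increasing; [apply exp_pos|].
    pose proof exp_le_3. lra. }
  pose proof (ln_nonneg X HX) as LX.
  assert (E : INR t * ln 4 <= ln 4 + ln X).
  { rewrite <- ln_pow, <- ln_mult by lra.
    destruct H as [H| ->]; [left; apply ln_increasing; [apply pow_lt; lra | exact H] | right; reflexivity]. }
  pose proof (pos_INR t). nra.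
Qed.

Theorem theorem1 (n : nat) (hn5 : (5 <= n)%nat) (hn4 : (n mod 4 = 1)%nat) :
  exists c : R, 0 < c /\
  forall (A B C D : R) (s : Z),
    1 <= A -> 1 <= B -> 0 <= C -> 0 <= D -> squarefree s ->
    INR (T_n n A B C D s) <=
    c * ( Rpower (A * B) (2 / 3) * logm (A * B)
          + A * logm (A * B) + B * logm (A * B)
          + Rpower (A * B) (1 / 3) *
            (logm (A * B * C * D) * logm (A * B) / logm (logm (A * B * C * D))) ^ 2 ).
Proof.
  assert (on : Nat.odd n = true).
  { rewrite (Nat.div_mod_eq n 4), hn4, Nat.odd_add, Nat.odd_mul. reflexivity. }
  destruct (Delta_count on ltac:(lia)) as [K HK].
  (* The factor by which the power of four near (AB)^(1/3) is enlarged, so that t >= 6 and n <=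
     4^t. *)
  set (w := 4 ^ (6 + n)). set (k := INR K).
  assert (Hw : 1 <= w) by (apply pow_R1_Rle; lra).
  assert (Hk : 0 <= k) by apply pos_INR.
  assert (Hn : 0 <= INR n) by apply pos_INR.
  (* The factor n + 9 comes from t + 1 <= (n + 9) L, the next one from the bound [T2] on [Q], and
     the 1 makes the constant positive. *)
  exists (k * (INR n + 9) * (9 + 16 * w ^ 2) + 1).
  split. { assert (0 <= k * (INR n + 9) * (9 + 16 * w ^ 2)); [|lra].
    apply Rmult_le_pos; [apply Rmult_le_pos; lra | nra]. }
  intros A B C D s HA HB HC HD _.
  destruct (INR_floor C HC) as [c Hc]. destruct (INR_floor D HD) as [d Hd].
  (* An offset is less than A + 1 because C < c + 1, and the floor of A + 2 exceeds A + 1, so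
     offsets lie strictly below a; also a <= 3A. *)
  destruct (INR_floor (A + 2) ltac:(lra)) as [a Ha].
  destruct (INR_floor (B + 2) ltac:(lra)) as [b Hb].
  set (P := A * B). assert (HP : 1 <= P) by (unfold P; nra).
  set (X := Rpower P (1 / 3)).
  pose proof (ln_nonneg P HP) as lnP.
  assert (HX : 1 <= X).
  { apply Rle_trans with (Rpower P 0); [right; symmetry; apply Rpower_O; lra | apply Rle_Rpower; lra]. }
  assert (X2 : Rpower P (2 / 3) = X ^ 2).
  { unfold X. rewrite <- Rpower_pow by apply exp_pos. rewrite Rpower_mult. f_equal. simpl. lra. }
  assert (X3 : X ^ 3 = P).
  { unfold X. rewrite <- Rpower_pow by apply exp_pos. rewrite Rpower_mult.
    replace (1 / 3 * INR 3) with 1 by (simpl; lra). apply Rpower_1. lra. }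
  destruct (pow4_between X HX) as [t1 Ht1].
  pose proof (pow4_exponent_le X t1 HX (proj2 Ht1)) as Ht.
  assert (lnX : ln X <= logm P).
  { unfold X, Rpower. rewrite ln_exp. apply Rle_trans with (ln P); [lra | apply Rmax_l]. }
  pose proof (logm_ge1 P) as HL.
  set (L := logm P) in *.
  destruct (shifted_pairs n A B C D s c d (proj1 Hc) (proj1 Hd)) as [S [uS [<- HS]]].
  set (t := (t1 + (6 + n))%nat).
  assert (nt : (n <= Nat.pow 4 t)%nat).
  { apply Nat.le_trans with (Nat.pow 4 n).
    - apply Nat.lt_le_incl, Nat.pow_gt_lin_r. lia.
    - apply Nat.pow_le_mono_r; unfold t; lia. }
  assert (a0 : (0 < a)%nat) by (apply INR_lt; simpl; lra).
  assert (b0 : (0 < b)%nat) by (apply INR_lt; simpl; lra).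
  pose proof (HK t a b c d s S ltac:(unfold t; lia) nt a0 b0 uS) as H.
  assert (HS' : forall e, In e S -> lt (fst e) a /\ lt (snd e) b /\
    exists r : Z, Defs.Delta n (Z.of_nat (c + fst e)) (Z.of_nat (d + snd e)) = (s * r ^ 2)%Z).
  { intros e He. destruct (HS e He) as [H1 [H2 H3]]. rewrite plus_INR in H1, H2.
    split; [apply INR_lt; lra | split; [apply INR_lt; lra | exact H3]]. }
  specialize (H HS'). apply le_INR in H.
  repeat rewrite ?mult_INR, ?plus_INR, ?pow_INR in H.
  set (z := INR 4 ^ t) in H.
  assert (zE : z = 4 ^ t1 * w).
  { unfold z, w, t. rewrite pow_add. simpl INR. replace (1 + 1 + 1 + 1) with 4 by lra. reflexivity. }
  assert (z1 : X <= z) by (rewrite zE; nra).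
  assert (z2 : z <= 4 * w * X) by (rewrite zE; nra).
  assert (tL : INR (Datatypes.S t) <= (INR n + 9) * L).
  { unfold t. rewrite S_INR, !plus_INR. simpl (INR 6). nra. }
  set (N := INR (length S)) in *.
  fold k in H.
  (* What remains of the sieve bound after division by z: the product a b is at most 9 X^3, hence at
     most 9 z X^2. *)
  set (Q := 9 * X ^ 2 + z ^ 2 + 3 * (A + B)).
  assert (Y : INR a * INR b + z ^ 3 + z * (INR a + INR b) <= z * Q).
  { assert (INR a * INR b <= (3 * A) * (3 * B)).
    { apply Rmult_le_compat; try apply pos_INR; lra. }
    assert (9 * P <= 9 * (z * X ^ 2)).
    { rewrite <- X3. simpl. nra. }
    assert (z * (INR a + INR b) <= z * (3 * (A + B))).
    { apply Rmult_le_compat_l; lra. }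
    unfold Q. unfold P in *. nra. }
  assert (T1 : N <= k * ((INR n + 9) * L) * Q).
  { apply Rmult_le_reg_l with z; [lra|].
    apply Rle_trans with (1 := H).
    replace (z * (k * ((INR n + 9) * L) * Q)) with ((k * ((INR n + 9) * L)) * (z * Q)) by ring.
    apply Rmult_le_compat; [| | | exact Y].
    - apply Rmult_le_pos; [exact Hk | apply pos_INR].
    - pose proof (pos_INR a). pose proof (pos_INR b).
      assert (0 <= z ^ 3) by (apply pow_le; lra). nra.
    - apply Rmult_le_compat_l; assumption. }
  assert (T2 : Q <= (9 + 16 * w ^ 2) * (X ^ 2 + A + B)).
  { assert (z ^ 2 <= (4 * w * X) ^ 2) by (apply pow_incr; lra).
    unfold Q. nra. }
  (* The fourth summand of the bound is a positive number times a square, so [T3] yields the full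
     inequality. *)
  set (E := X * (logm (P * C * D) * L / logm (logm (P * C * D))) ^ 2).
  assert (E0 : 0 <= E).
  { unfold E. apply Rmult_le_pos; [lra | apply pow2_ge_0]. }
  rewrite X2.
  set (G := k * (INR n + 9) * (9 + 16 * w ^ 2)).
  assert (G0 : 0 <= G).
  { apply Rmult_le_pos; [apply Rmult_le_pos; lra | nra]. }
  assert (V0 : 0 <= X ^ 2 + A + B) by nra.
  assert (T3 : N <= G * (L * (X ^ 2 + A + B))).
  { apply Rle_trans with (1 := T1).
    replace (G * (L * (X ^ 2 + A + B))) with
      (k * ((INR n + 9) * L) * ((9 + 16 * w ^ 2) * (X ^ 2 + A + B))) by (unfold G; ring).
    apply Rmult_le_compat_l; [|exact T2].
    apply Rmult_le_pos; [lra | nra]. }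
  assert (0 <= L * (X ^ 2 + A + B)) by (apply Rmult_le_pos; lra).
  assert (0 <= G * E) by (apply Rmult_le_pos; lra).
  apply Rle_trans with (1 := T3).
  replace (X ^ 2 * L + A * L + B * L + E) with (L * (X ^ 2 + A + B) + E) by ring.
  nra.
Qed.
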